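(* Consider the parametrized Stokes-Brinkman problem described in the context, with its finite element spaces $V_h, Q_h$ and reduced basis spaces $V_r \subset V_h$, $Q_r \subset Q_h$. Let $\xi \in \Gamma$, let $(u_h(\xi),p_h(\xi)) \in V_h \times Q_h$ be the high-fidelity solution and let $(u_r(\xi),p_r(\xi)) \in V_r \times Q_r$ be the reduced basis solution. Let $\alpha(\xi)$, $\gamma(\xi)$ and $\beta$ be the coercivity, continuity and inf-sup constants defined in the context, and let $\alpha^{\mathrm{LB}}(\xi), \gamma^{\mathrm{UB}}(\xi)$ be real numbers with $0 < \alpha^{\mathrm{LB}}(\xi) \leq \alpha(\xi)$ and $\gamma^{\mathrm{UB}}(\xi) \geq \gamma(\xi)$. Define $$\Delta_r^u(\xi) = \frac{1}{\alpha^{\mathrm{LB}}(\xi)}\|r_1(\cdot;\xi)\|_{V_h^\star} + \frac{2}{\beta}\sqrt{\frac{\gamma^{\mathrm{UB}}(\xi)}{\alpha^{\mathrm{LB}}(\xi)}}\,\|r_2(\cdot;\xi)\|_{Q_h^\star},$$ $$\Delta_r^p(\xi) = \frac{2}{\beta}\sqrt{\frac{\gamma^{\mathrm{UB}}(\xi)}{\alpha^{\mathrm{LB}}(\xi)}}\,\|r_1(\cdot;\xi)\|_{V_h^\star} + \frac{\gamma^{\mathrm{UB}}(\xi)}{\beta^2}\,\|r_2(\cdot;\xi)\|_{Q_h^\star},$$ where $r_1(\cdot;\xi)$ and $r_2(\cdot;\xi)$ are the reduced basis residuals defined in the context. Then $$\|u_h(\xi)-u_r(\xi)\|_V \leq \Delta_r^u(\xi)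 \quad\text{and}\quad \|p_h(\xi)-p_r(\xi)\|_Q \leq \Delta_r^p(\xi).$$
   Context: Let $D \subset \mathbb{R}^d$, $d \in \{2,3\}$, be a bounded, connected, open domain with Lipschitz boundary $\partial D$, split into a Dirichlet part $\partial D_D$ and a Neumann part $\partial D_N$, both of positive surface measure. Let $\nu^*$ be the effective viscosity, a positive function on $D$ that is bounded above and bounded below by a positive constant. Let $\Gamma \subset \mathbb{R}^M$ be a product of compact intervals (the parameter set). For each $\xi\in\Gamma$, let $\mathbf{K}(\xi)$ be a permeability tensor on $D$, that is, a field of diagonal symmetric positive definite matrices with $\mathbf{K}(\xi)^{-1}$ bounded on $D$. Let $V = \{u \in H^1(D)^d : u = 0 \text{ on } \partial D_D\}$ with inner product $(u,v)_V = \int_D \nabla u : \nabla v$, where $\nabla u:\nabla v = \sum_{i=1}^d \nabla u_i\cdot\nabla v_i$, and let $Q = L^2(D)$ with its usual norm. Define $$a(u,v;\xi) = \int_D \nu^* \nabla u : \nabla v + \int_D u\cdot(\mathbf{K}(\xi)^{-1} v), \quad u,v \in H^1(D)^d,$$ $$b(v,q) = -\int_D q\,\nabla\cdot v, \quad v \in H^1(D)^d,\ q\in L^2(D).$$ Given a forcing term $f$, Neumann data $u_N$ on $\partial D_N$, and a fixed $w \in H^1(D)^d$ satisfying the Dirichlet boundary conditions on $\partial D_D$, define the bounded linear functionals $$\ell_1(v;\xi) = \int_D f\cdot v - a(w,v;\xi) + \int_{\partial D_N} u_N\cdot v \ \ (v\in V), \qquad \ell_2(q) = -b(w,q) \ \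 (q \in Q).$$ Finite element (high-fidelity) problem: $V_h\subset V$ and $Q_h \subset Q$ are finite-dimensional conforming subspaces that are inf-sup stable, i.e. $$\beta := \inf_{q\in Q_h}\sup_{v\in V_h}\frac{b(v,q)}{\|q\|_Q\|v\|_V} > 0$$ (infima and suprema are over nonzero elements). The high-fidelity solution $(u_h(\xi),p_h(\xi))\in V_h\times Q_h$ is the solution of $$a(u_h(\xi),v;\xi)+b(v,p_h(\xi)) = \ell_1(v;\xi)\ \ \forall v\in V_h, \qquad b(u_h(\xi),q)=\ell_2(q)\ \ \forall q\in Q_h.$$ The coercivity and continuity constants are $$\alpha(\xi) = \inf_{v\in V_h}\frac{a(v,v;\xi)}{\|v\|_V^2}, \qquad \gamma(\xi) = \sup_{u,v\in V_h}\frac{a(u,v;\xi)}{\|u\|_V\|v\|_V}.$$ Reduced basis problem: $V_r\subset V_h$ and $Q_r\subset Q_h$ are linear subspaces chosen such that $b$ also satisfies an inf-sup condition on $V_r\times Q_r$. The reduced basis solution $(u_r(\xi),p_r(\xi))\in V_r\times Q_r$ is the solution of $$a(u_r(\xi),v;\xi)+b(v,p_r(\xi)) = \ell_1(v;\xi)\ \ \forall v\in V_r, \qquad b(u_r(\xi),q)=\ell_2(q)\ \ \forall q\in Q_r.$$ The residuals $r_1(\cdot;\xi)\in V_h^\star$ and $r_2(\cdot;\xi)\in Q_h^\star$ are $$r_1(v;\xi) = \ell_1(v;\xi)-a(u_r(\xi),v;\xi)-b(v,p_r(\xi)) \ \ (v \in V_h), \qquad r_2(q;\xi)=\ell_2(q)-b(u_r(\xi),q)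 \ \ (q\in Q_h).$$ The dual norms are $\|r_1\|_{V_h^\star} = \sup_{0\ne v\in V_h} r_1(v)/\|v\|_V$ and $\|r_2\|_{Q_h^\star} = \sup_{0\neq q\in Q_h} r_2(q)/\|q\|_Q$. *)

(* Defs.v *)
From HB Require Import structures.
From mathcomp Require Import all_boot all_order all_algebra.
From mathcomp Require Import all_classical all_reals all_analysis.

Set Implicit Arguments.
Unset Strict Implicit.
Unset Printing Implicit Defensive.

Import Order.TTheory GRing.Theory Num.Theory.
Import numFieldNormedType.Exports.

Local Open Scope classical_set_scope.
Local Open Scope ring_scope.

(* The largest outer measure below a set function tau; unlike [mu_ext], covers
   by arbitrary sets are allowed. *)
Section CoverExtension.
Context {R : realType} {T : pointedType}.
Local Open Scope ereal_scope.

Definition cover_ext (tau : set T -> \bar R) (A : set T) : \bar R :=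
  ereal_inf [set \sum_(k <oo) tau (F k) |
              F in [set F : (set T)^nat | A `<=` \bigcup_k F k]].

Variable tau : set T -> \bar R.
Hypotheses (tau0 : tau set0 = 0) (tau_ge0 : forall A, 0 <= tau A).

Let discr : Type := g_sigma_algebraType [set: set T].

Let cover_extE A : cover_ext tau A = @mu_ext _ discr R tau A.
Proof.
rewrite /cover_ext /mu_ext; congr (ereal_inf (_ @` _)).
apply/seteqP; split => [F AF|F []//]; split => // i.
exact: sub_sigma_algebra.
Qed.

Lemma cover_ext0 : cover_ext tau set0 = 0.
Proof. by rewrite cover_extE mu_ext0. Qed.

Lemma cover_ext_ge0 A : 0 <= cover_ext tau A.
Proof. by rewrite cover_extE mu_ext_ge0. Qed.

Lemma le_cover_ext : {homo cover_ext tau : A B / A `<=` B >-> A <= B}.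
Proof. by move=> A B AB; rewrite !cover_extE; exact: le_mu_ext. Qed.

Lemma cover_ext_sigma_subadditive : sigma_subadditive (cover_ext tau).
Proof.
move=> F; rewrite cover_extE.
under eq_eseriesr do rewrite cover_extE.
exact: (@mu_ext_sigma_subadditive _ discr).
Qed.

End CoverExtension.

Section Measures.
Context {R : realType}.
Implicit Types d s : nat.

Definition enorm d (x : 'rV[R]_d) : R := Num.sqrt (\sum_i x 0 i ^+ 2).

Definition box d (a b : 'rV[R]_d) : set 'rV[R]_d :=
  [set x | forall i, a 0 i < x 0 i <= b 0 i].

(* The volume of the smallest half-open box around A, +oo if A is unbounded. *)
Definition box_gauge d (A : set 'rV[R]_d) : \bar R :=
  if A == set0 then 0%E else
  ereal_inf [set (\prod_i (p.2 0 i - p.1 0 i))%:E |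
              p in [set p : 'rV[R]_d * 'rV[R]_d | A `<=` box p.1 p.2]].

Definition lebesgue_outer d : set 'rV[R]_d -> \bar R :=
  cover_ext (@box_gauge d).

(* normalizes the Hausdorff measure so that it is the usual length and area *)
Definition unit_ball_volume s : R :=
  fine (lebesgue_outer [set y : 'rV[R]_s | enorm y <= 1]).

Definition diameter d (A : set 'rV[R]_d) : \bar R :=
  ereal_sup [set (enorm (p.1 - p.2))%:E | p in A `*` A].

Definition hausdorff_gauge d s (delta : R) (A : set 'rV[R]_d) : \bar R :=
  if A == set0 then 0%E else
  if (diameter A <= delta%:E)%E
  then (unit_ball_volume s * (fine (diameter A) / 2) ^+ s)%:E else +oo%E.

Definition hausdorff_outer d s (A : set 'rV[R]_d) : \bar R :=
  ereal_sup [set cover_ext (hausdorff_gauge s delta) A |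
              delta in [set delta : R | 0 < delta]].

Lemma box_gauge0 d : @box_gauge d set0 = 0%E.
Proof. by rewrite /box_gauge eqxx. Qed.

Lemma box_gauge_ge0 d (A : set 'rV[R]_d) : (0 <= box_gauge A)%E.
Proof.
rewrite /box_gauge; case: eqP => // /eqP/set0P[x Ax].
apply: le_ereal_inf_tmp => _ [[a b] /= /(_ _ Ax) xab <-].
rewrite lee_fin; apply: prodr_ge0 => i _; rewrite subr_ge0.
by have /andP[/ltW ax xb] := xab i; exact: le_trans ax xb.
Qed.

Lemma unit_ball_volume_ge0 s : 0 <= unit_ball_volume s.
Proof. exact/fine_ge0/cover_ext_ge0/box_gauge_ge0. Qed.

Lemma hausdorff_gauge0 d s delta : @hausdorff_gauge d s delta set0 = 0%E.
Proof. by rewrite /hausdorff_gauge eqxx. Qed.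

Lemma hausdorff_gauge_ge0 d s delta (A : set 'rV[R]_d) :
  (0 <= hausdorff_gauge s delta A)%E.
Proof.
rewrite /hausdorff_gauge; case: eqP => // /eqP/set0P[x Ax].
case: ifPn => // _; rewrite lee_fin mulr_ge0 ?unit_ball_volume_ge0//.
rewrite exprn_ge0// divr_ge0// fine_ge0//; apply: ereal_sup_ubound.
exists (x, x) => //=; rewrite subrr /enorm big1 ?sqrtr0// => i _.
by rewrite mxE expr0n.
Qed.

HB.instance Definition _ d := isOuterMeasure.Build R _ (@lebesgue_outer d)
  (cover_ext0 (box_gauge0 d) (@box_gauge_ge0 d))
  (cover_ext_ge0 (@box_gauge_ge0 d))
  (@le_cover_ext _ _ _)
  (cover_ext_sigma_subadditive (@box_gauge_ge0 d)).

Lemma hausdorff_outer0 d s : @hausdorff_outer d s set0 = 0%E.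
Proof.
rewrite /hausdorff_outer (_ : [set _ | _ in _] = [set 0%E]) ?ereal_sup1//.
apply/seteqP; split => [_ [delta _ <-]|_ ->].
  exact: cover_ext0 (hausdorff_gauge0 _ _ _) (hausdorff_gauge_ge0 _ _).
exists 1 => //=.
exact: cover_ext0 (hausdorff_gauge0 _ _ _) (hausdorff_gauge_ge0 _ _).
Qed.

Lemma hausdorff_outer_ge0 d s (A : set 'rV[R]_d) :
  (0 <= hausdorff_outer s A)%E.
Proof.
apply: le_ereal_sup_tmp; exists (cover_ext (hausdorff_gauge s 1) A).
  by exists 1 => //=.
exact/cover_ext_ge0/hausdorff_gauge_ge0.
Qed.

Lemma le_hausdorff_outer d s :
  {homo @hausdorff_outer d s : A B / A `<=` B >-> (A <= B)%E}.
Proof.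
move=> A B AB; apply: ge_ereal_sup => _ [delta delta_gt0 <-].
apply: le_ereal_sup_tmp; exists (cover_ext (hausdorff_gauge s delta) B).
  by exists delta.
exact: le_cover_ext.
Qed.

Lemma hausdorff_outer_sigma_subadditive d s :
  sigma_subadditive (@hausdorff_outer d s).
Proof.
move=> F; apply: ge_ereal_sup => _ [delta delta_gt0 <-].
have ge0 := @hausdorff_gauge_ge0 d s delta.
apply: le_trans (cover_ext_sigma_subadditive ge0 F) _.
apply: lee_nneseries => [i _ _|i _]; first exact/cover_ext_ge0.
by apply: ereal_sup_ubound; exists delta.
Qed.

HB.instance Definition _ d s := isOuterMeasure.Build R _ (@hausdorff_outer d s)
  (@hausdorff_outer0 d s) (@hausdorff_outer_ge0 d s)
  (@le_hausdorff_outer d s) (@hausdorff_outer_sigma_subadditive d s).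

End Measures.

(* Lebesgue measure on R^d and surface measure on subsets of R^d, i.e. the
   (d-1)-dimensional Hausdorff measure, each on the sigma-algebra of the
   Caratheodory-measurable sets of its outer measure. *)
Section CaratheodoryMeasures.
Variables (R : realType) (d : nat).

Let leb : {outer_measure set 'rV[R]_d -> \bar R} := @lebesgue_outer R d.
Let surf : {outer_measure set 'rV[R]_d -> \bar R} := @hausdorff_outer R d d.-1.

Definition lebesgue : {measure set (caratheodory_type leb) -> \bar R} := leb.

Definition surface_measurable (S : set 'rV[R]_d) : Prop :=
  surf.-cara.-measurable S.

Definition surface : {measure set (caratheodory_type surf) -> \bar R} := surf.

End CaratheodoryMeasures.

Section Domain.
Context {R : realType} {d : nat}.
Implicit Types D : set 'rV[R]_d.

Definition boundary D : set 'rV[R]_d := closure D `\` interior D.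

(* Near each boundary point, in suitable Cartesian coordinates y, the domain
   is the region below the graph of a Lipschitz function of the coordinates
   other than y_k. *)
Definition lipschitz_boundary D :=
  forall x0, boundary D x0 ->
  exists (O : 'M[R]_d) (k : 'I_d) (psi : 'rV[R]_d.-1 -> R),
  [/\ O *m O^T = 1%:M,
      [lipschitz psi y | y in setT] &
      \forall x \near x0,
        D x <-> (x *m O) 0 k < psi (col' k (x *m O))].

End Domain.

Section Sobolev.
Context {R : realType} {d : nat}.
Implicit Types D S : set 'rV[R]_d.

Definition L2 (disp : measure_display) (T : measurableType disp)
    (mu : {measure set T -> \bar R}) (S : set T) (f : T -> R) :=
  measurable_fun S f /\ mu.-integrable S (fun x => (f x ^+ 2)%:E).

Definition bounded_measurable (disp : measure_display)
    (T : measurableType disp) (mu : {measure set T -> \bar R}) (S : set T)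
    (f : T -> R) :=
  measurable_fun S f /\ exists C, forall x, S x -> `|f x| <= C.

Definition partial (j : 'I_d) (f : 'rV[R]_d -> R) : 'rV[R]_d -> R :=
  fun x => 'D_(delta_mx 0 j) f x.

Definition smooth (f : 'rV[R]_d -> R) :=
  forall s : seq 'I_d,
    let g := foldr partial f s in
    continuous g /\ forall x j, derivable g x (delta_mx 0 j).

Definition test_function D (phi : 'rV[R]_d -> R) :=
  smooth phi /\
  exists C, [/\ compact C, C `<=` D & forall x, ~ C x -> phi x = 0].

(* An element of H^1(D)^d is represented by a pair (v, G), where v is a
   function with values in R^d and the matrix field G, G_ij = d_j v_i, is its
   weak gradient on D. *)
Definition field : Type := (('rV[R]_d -> 'rV[R]_d) * ('rV[R]_d -> 'M[R]_d))%type.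

Definition grad (v : field) : 'rV[R]_d -> 'M[R]_d := v.2.

Definition div (v : field) : 'rV[R]_d -> R := fun x => \tr (grad v x).

Definition H1 D : set field := [set v : field |
  [/\ forall i, L2 (lebesgue R d) D (fun x => v.1 x 0 i),
      forall i j, L2 (lebesgue R d) D (fun x => grad v x i j) &
      forall i j phi, test_function D phi ->
        \int[lebesgue R d]_(x in D) (v.1 x 0 i * partial j phi x) =
        - \int[lebesgue R d]_(x in D) (grad v x i j * phi x)]].

(* Equality in H^1(D)^d, i.e. up to a null set. For elements of H^1(D)^d the
   second clause follows from the first, a weak gradient being unique. *)
Definition H1_eq D (u v : field) :=
  ae_eq (lebesgue R d) D u.1 v.1 /\ ae_eq (lebesgue R d) D (grad u) (grad v).

Definition H1_dist2 D (u v : field) : \bar R :=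
  (\int[lebesgue R d]_(x in D)
    (enorm (u.1 x - v.1 x) ^+ 2 +
     \sum_i \sum_j (grad u x i j - grad v x i j) ^+ 2)%:E)%E.

Definition classical_field (f : 'rV[R]_d -> 'rV[R]_d) : field :=
  (f, fun x => \matrix_(i, j) partial j (fun y => f y 0 i) x).

(* The trace on the boundary of D is the continuous extension to H^1(D)^d of
   the restriction to the boundary, L^2(boundary)-valued. *)
Definition is_trace D (v : field) (g : 'rV[R]_d -> 'rV[R]_d) :=
  (forall i, L2 (surface R d) (boundary D) (fun x => g x 0 i)) /\
  exists f : nat -> 'rV[R]_d -> 'rV[R]_d,
  [/\ forall n i, smooth (fun x => f n x 0 i),
      H1_dist2 D (classical_field (f n)) v @[n --> \oo] --> 0%E &
      (\int[surface R d]_(x in boundary D) (enorm (f n x - g x) ^+ 2)%:E)%E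
        @[n --> \oo] --> 0%E].

Definition trace D (v : field) : 'rV[R]_d -> 'rV[R]_d :=
  get (is_trace D v).

(* v = g on the part S of the boundary of D *)
Definition trace_eq D S (v : field) (g : 'rV[R]_d -> 'rV[R]_d) :=
  exists2 h, is_trace D v h & ae_eq (surface R d) S h g.

Definition Vspace D (bD : set 'rV[R]_d) : set field :=
  [set v : field | H1 D v /\ trace_eq D bD v (cst 0)].

Definition Qspace D : set ('rV[R]_d -> R) := [set q | L2 (lebesgue R d) D q].

Definition Q_eq D (p q : 'rV[R]_d -> R) := ae_eq (lebesgue R d) D p q.

Definition innerV D (u v : field) : R :=
  \int[lebesgue R d]_(x in D) (\sum_i \sum_j grad u x i j * grad v x i j).

Definition normV D (v : field) : R := Num.sqrt (innerV D v v).

Definition normQ D (q : 'rV[R]_d -> R) : R :=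
  Num.sqrt (\int[lebesgue R d]_(x in D) (q x ^+ 2)).

End Sobolev.

Arguments field : clear implicits.

Definition linear_subspace (R : pzRingType) (E : lmodType R) (S : set E) :=
  S 0 /\ forall (c : R) (u v : E), S u -> S v -> S (c *: u + v).

(* dimension is counted up to the identification eqE of elements of E *)
Definition finite_dimensional (R : pzRingType) (E : lmodType R)
    (eqE : E -> E -> Prop) (S : set E) :=
  exists (n : nat) (e : 'I_n -> E), (forall i, S (e i)) /\
  forall v, S v -> exists c : 'I_n -> R, eqE v (\sum_i c i *: e i).

Definition nonzero (R : pzRingType) (E : lmodType R) (eqE : E -> E -> Prop)
    (S : set E) : set E := [set v | S v /\ ~ eqE v 0].

Definition dual_norm (R : realType) (E : lmodType R) (eqE : E -> E -> Prop)
    (norm : E -> R) (S : set E) (r : E -> R) : \bar R :=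
  ereal_sup [set (r v / norm v)%:E | v in nonzero eqE S].

Definition parameter_box (R : realType) (M : nat) (lo hi : 'rV[R]_M) :
    set 'rV[R]_M := [set xi | forall i, lo 0 i <= xi 0 i <= hi 0 i].

Section StokesBrinkman.
Context {R : realType} {d : nat}.

(* the domain D and the Neumann part bN of its boundary *)
Variables (D bN : set 'rV[R]_d).
(* effective viscosity, and permeability at a fixed parameter *)
Variables (nu : 'rV[R]_d -> R) (K : 'rV[R]_d -> 'M[R]_d).
(* forcing term, Neumann data, lifting of the Dirichlet data *)
Variables (f uN : 'rV[R]_d -> 'rV[R]_d) (w : field R d).

Implicit Types (u v : field R d) (p q : 'rV[R]_d -> R).
Implicit Types (V : set (field R d)) (Q : set ('rV[R]_d -> R)).

Definition viscosity :=
  bounded_measurable (lebesgue R d) D nu /\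
  exists2 c, 0 < c & forall x, D x -> c <= nu x.

Definition permeability :=
  (forall x, D x -> [/\ is_diag_mx (K x), (K x)^T = K x &
     forall y : 'rV[R]_d, y != 0 -> 0 < (y *m K x *m y^T) 0 0]) /\
  forall i j, bounded_measurable (lebesgue R d) D (fun x => invmx (K x) i j).

Definition aform u v : R :=
  \int[lebesgue R d]_(x in D)
    (nu x * \sum_i \sum_j grad u x i j * grad v x i j) +
  \int[lebesgue R d]_(x in D) ((u.1 x *m (invmx (K x) *m (v.1 x)^T)) 0 0).

Definition bform v q : R := - \int[lebesgue R d]_(x in D) (q x * div v x).

Definition ell1 v : R :=
  \int[lebesgue R d]_(x in D) (\sum_i f x 0 i * v.1 x 0 i) - aform w v +
  \int[surface R d]_(x in bN) (\sum_i uN x 0 i * trace D v x 0 i).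

Definition ell2 q : R := - bform w q.

Definition is_solution V Q u p :=
  [/\ V u, Q p,
      forall v, V v -> aform u v + bform v p = ell1 v &
      forall q, Q q -> bform u q = ell2 q].

Definition residual1 u p v : R := ell1 v - aform u v - bform v p.

Definition residual2 u q : R := ell2 q - bform u q.

(* The suprema and infima below are taken in the extended reals, so none of
   them hides an unbounded or empty family behind a default value. *)
Definition inf_sup V Q : \bar R :=
  ereal_inf [set ereal_sup [set (bform v q / (normQ D q * normV D v))%:E |
                             v in nonzero (H1_eq D) V] | q in nonzero (Q_eq D) Q].

Definition coercivity V : \bar R :=
  ereal_inf [set (aform v v / normV D v ^+ 2)%:E | v in nonzero (H1_eq D) V].

Definition continuity V : \bar R :=
  ereal_sup [set (aform z.1 z.2 / (normV D z.1 * normV D z.2))%:E |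
              z in nonzero (H1_eq D) V `*` nonzero (H1_eq D) V].

Definition dual_normV V (r : field R d -> R) : \bar R :=
  dual_norm (H1_eq D) (normV D) V r.

Definition dual_normQ Q (r : ('rV[R]_d -> R) -> R) : \bar R :=
  dual_norm (Q_eq D) (normQ D) Q r.

End StokesBrinkman.

(* Main.v *)
Require Import Defs.
From HB Require Import structures.
From mathcomp Require Import all_boot all_order all_algebra.
From mathcomp Require Import all_classical all_reals all_analysis.
From mathcomp Require Import measurable_realfun ring lra.

Set Implicit Arguments.
Unset Strict Implicit.
Unset Printing Implicit Defensive.

Import Order.TTheory GRing.Theory Num.Theory.
Import numFieldNormedType.Exports.

Local Open Scope classical_set_scope.
Local Open Scope ring_scope.

(* On V_h the residuals are v |-> a(e, v) + b(v, p) and q |-> b(e, q), where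
   (e, p) is the error, so the claim is a stability estimate for a saddle point
   problem. The form a is an inner product on V_h. Let P be the a-orthogonal
   projection onto the a-orthogonal complement of ker b. Then
   - e - Pe lies in ker b, so a(e - Pe, e - Pe) = r_1(e - Pe), which bounds it by
     r_1 / alpha;
   - a(Pe, .) = b(., p') for some p' in Q_h, so a(Pe, Pe) = r_2(p'), while the
     inf-sup condition gives beta |p'| <= sqrt gamma |Pe|_a;
   - b(z, p) = b(Pz, p) = r_1(Pz) - a(Pe, Pz) with |Pz|_a <= |z|_a, and the
     inf-sup condition turns this into the bound on p.
   This gives the velocity and pressure bounds even without the factors 2. *)

(** * Linear and bilinear forms on subspaces *)

Section BilinearForms.
Context {R : realType}.

(** Linearity is asked on [S] only: the integral forms below are additive only where their
    integrands are integrable, which membership in [S] will ensure. *)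
Definition linear_on (E : lmodType R) (S : set E) (l : E -> R) :=
  forall (c : R) u v, S u -> S v -> l (c *: u + v) = c * l u + l v.

Definition bilinear_on (E F : lmodType R) (V : set E) (Q : set F)
    (b : E -> F -> R) :=
  (forall q, Q q -> linear_on V (b ^~ q)) /\ (forall v, V v -> linear_on Q (b v)).

Section Linear.
Variables (E : lmodType R) (S : set E).
Hypothesis SS : linear_subspace S.

Lemma linear_subspaceZ (c : R) u : S u -> S (c *: u).
Proof. by case: SS => S0 Sl Su; rewrite -[_ *: _]addr0; exact: Sl. Qed.

Lemma linear_subspaceD u v : S u -> S v -> S (u + v).
Proof. by case: SS => S0 Sl Su Sv; rewrite -[u]scale1r; exact: Sl. Qed.

Lemma linear_subspaceN u : S u -> S (- u).
Proof. by rewrite -scaleN1r; exact: linear_subspaceZ. Qed.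

Lemma linear_subspaceB u v : S u -> S v -> S (u - v).
Proof. by move=> Su Sv; apply/linear_subspaceD/linear_subspaceN. Qed.

Lemma linear_subspace_sum n (c : 'I_n -> R) e :
  (forall i, S (e i)) -> S (\sum_i c i *: e i).
Proof.
move=> Se; case: SS => S0 _.
by elim/big_ind: _ => // [u v|i _]; [exact: linear_subspaceD|exact: linear_subspaceZ].
Qed.

Variable l : E -> R.
Hypothesis lS : linear_on S l.

Lemma linear_on0 : l 0 = 0.
Proof.
case: SS => S0 _; have := lS 1 S0 S0; rewrite scaler0 addr0 mul1r => h.
by apply: (addrI (l 0)); rewrite -h addr0.
Qed.

Lemma linear_onZ c u : S u -> l (c *: u) = c * l u.
Proof.
by case: SS => S0 _ Su; rewrite -[_ *: _]addr0 lS// linear_on0 addr0.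
Qed.

Lemma linear_onD u v : S u -> S v -> l (u + v) = l u + l v.
Proof. by move=> Su Sv; rewrite -[u in LHS]scale1r lS// mul1r. Qed.

Lemma linear_onN u : S u -> l (- u) = - l u.
Proof. by move=> Su; rewrite -scaleN1r linear_onZ// mulN1r. Qed.

Lemma linear_onB u v : S u -> S v -> l (u - v) = l u - l v.
Proof.
by move=> Su Sv; rewrite linear_onD ?linear_onN//; exact: linear_subspaceN.
Qed.

Lemma linear_on_sum n (c : 'I_n -> R) e : (forall i, S (e i)) ->
  l (\sum_i c i *: e i) = \sum_i c i * l (e i).
Proof.
elim: n c e => [|n IH] c e Se; first by rewrite !big_ord0 linear_on0.
rewrite !big_ord_recr/= linear_onD ?linear_onZ ?IH//.
  exact: linear_subspace_sum.
exact: linear_subspaceZ.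
Qed.

End Linear.

Lemma linear_on_sym (E : lmodType R) (V : set E) (s : E -> E -> R) :
  (forall u v, V u -> V v -> s u v = s v u) -> linear_subspace V ->
  (forall v, V v -> linear_on V (s ^~ v)) -> bilinear_on V V s.
Proof.
move=> s_sym VV sl; split=> // v Vv c u u' Vu Vu'.
have Vuu' := VV.2 c _ _ Vu Vu'.
by rewrite s_sym// sl// !(s_sym v).
Qed.

(** * Cauchy-Schwarz and triangle inequality for a positive semidefinite form *)

Section CauchySchwarz.
Variables (E : lmodType R) (V : set E) (s : E -> E -> R).
Hypotheses (VV : linear_subspace V) (sV : bilinear_on V V s).
Hypothesis s_sym : forall u v, V u -> V v -> s u v = s v u.
Hypothesis s_ge0 : forall u, V u -> 0 <= s u u.

Lemma bilinear_on_sqr u v c : V u -> V v ->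
  s (c *: u + v) (c *: u + v) = c ^+ 2 * s u u + c * s u v *+ 2 + s v v.
Proof.
move=> Vu Vv; have [sl sr] := sV; have Vuv : V (c *: u + v) by apply VV.2.
rewrite (sl _ Vuv)// (sr _ Vu)// (sr _ Vv)// (s_sym Vv Vu).
by rewrite mulr2n; ring.
Qed.

(** The quadratic c |-> s(cu + v, cu + v) is nonnegative. As [s] may be degenerate, s(u, u) = 0 is a
    separate case: the quadratic is then affine in c, so its slope must vanish. *)
Lemma cauchy_schwarz u v : V u -> V v -> s u v ^+ 2 <= s u u * s v v.
Proof.
move=> Vu Vv.
have h c : 0 <= c ^+ 2 * s u u + c * s u v *+ 2 + s v v.
  by rewrite -bilinear_on_sqr//; apply: s_ge0; apply VV.2.
have := s_ge0 Vu; rewrite le_eqVlt => /predU1P[uu0|uu_gt0].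
  have [->|uv0] := eqVneq (s u v) 0; first by rewrite -uu0 mul0r expr0n.
  (* This c is chosen so that the affine function takes the value -1. *)
  have := h (- (s v v + 1) / (s u v * 2)).
  rewrite -uu0 mulr0 add0r.
  have -> : - (s v v + 1) / (s u v * 2) * s u v *+ 2 + s v v = -1.
    by rewrite mulr2n; field.
  by rewrite ler0N1.
(* The minimizer of the quadratic. *)
have := h (- s u v / s u u).
have -> : (- s u v / s u u) ^+ 2 * s u u + - s u v / s u u * s u v *+ 2 + s v v
  = (s u u * s v v - s u v ^+ 2) / s u u.
  by rewrite mulr2n; field; rewrite gt_eqF.
by rewrite pmulr_lge0 ?invr_gt0// subr_ge0.
Qed.

Lemma cauchy_schwarz_sqrt u v : V u -> V v ->
  `|s u v| <= Num.sqrt (s u u) * Num.sqrt (s v v).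
Proof.
move=> Vu Vv; rewrite -sqrtrM ?s_ge0// -sqrtr_sqr ler_sqrt ?cauchy_schwarz//.
by rewrite mulr_ge0 ?s_ge0.
Qed.

Lemma sqrt_form_triangle u v : V u -> V v ->
  Num.sqrt (s (u + v) (u + v)) <= Num.sqrt (s u u) + Num.sqrt (s v v).
Proof.
move=> Vu Vv; have ge0 x : 0 <= Num.sqrt (s x x) by exact: sqrtr_ge0.
rewrite -(ler_pXn2r (ltn0Sn 1)) ?nnegrE ?addr_ge0//.
have Vuv := linear_subspaceD VV Vu Vv.
rewrite sqr_sqrtr ?s_ge0// sqrrD !sqr_sqrtr ?s_ge0//.
rewrite -[u in leLHS]scale1r bilinear_on_sqr// expr1n !mul1r lerD2r lerD2l.
rewrite lerMn2r/=; apply: le_trans (cauchy_schwarz_sqrt Vu Vv).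
exact: ler_norm.
Qed.

End CauchySchwarz.

End BilinearForms.

(** Fredholm alternative: the columns of [cokermx M] lie in the kernel of [M], so [u] annihilates
    them, and [u *m cokermx M = 0] characterizes the row space. *)
Lemma submx_ker (F : fieldType) m n (u : 'rV[F]_n) (M : 'M[F]_(m, n)) :
  (forall z : 'cV[F]_n, M *m z = 0 -> u *m z = 0) -> (u <= M)%MS.
Proof.
move=> h; rewrite submxE; apply/eqP/rowP => k.
have -> : (u *m cokermx M) 0 k = col k (u *m cokermx M) 0 0 by rewrite [RHS]mxE.
by rewrite colE -mulmxA h ?mxE// mulmxA mulmx_coker mul0mx.
Qed.

(** * Existence of the a-orthogonal projection onto the complement of ker b *)

Section SaddlePoint.
Context {R : realType} {E F : lmodType R}.
Variables (V : set E) (Q : set F) (a : E -> E -> R) (b : E -> F -> R).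
Hypotheses (VV : linear_subspace V) (QQ : linear_subspace Q).
Hypotheses (aV : bilinear_on V V a) (bVQ : bilinear_on V Q b).
Hypothesis a_sym : forall u v, V u -> V v -> a u v = a v u.
Hypothesis a_ge0 : forall u, V u -> 0 <= a u u.

(* The block system for (z, - p) in coordinates is symmetric, and its
   right-hand side vanishes on its kernel: for (x, y) in the kernel one gets
   a(x, x) = 0, hence a(x, .) = 0, hence b(., y) = 0. *)
Lemma saddle_projection n (e : 'I_n -> E) m (g : 'I_m -> F) v :
  (forall i, V (e i)) -> (forall j, Q (g j)) ->
  (forall z, V z -> exists c : 'I_n -> R,
    (forall u, V u -> a z u = a (\sum_i c i *: e i) u) /\
    (forall q, Q q -> b z q = b (\sum_i c i *: e i) q)) ->
  (forall q, Q q -> exists c : 'I_m -> R,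
    forall u, V u -> b u q = b u (\sum_j c j *: g j)) ->
  V v -> exists z p, [/\ V z, Q p, forall u, V u -> a z u = b u p &
    forall q, Q q -> b z q = b v q].
Proof.
move=> Ve Qg spanV spanQ Vv.
have [al ar] := aV; have [bl br] := bVQ.
pose A : 'M[R]_n := \matrix_(i, j) a (e i) (e j).
pose B : 'M[R]_(n, m) := \matrix_(i, j) b (e i) (g j).
pose M := block_mx A B B^T 0.
pose r : 'rV[R]_m := \row_j b v (g j).
have Vsum c := linear_subspace_sum VV c Ve.
have Qsum c := linear_subspace_sum QQ c Qg.
(* A row solving this system lists the coefficients of z and of -p. By [submx_ker] it exists once
   (0, r) vanishes on the kernel of [M]; [w] and [q] below are the elements with the coordinates of
   a kernel vector. *)
have /submxP[x /eqP] : (row_mx (0 : 'rV[R]_n) r <= M)%MS.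
  apply: submx_ker => z; rewrite -(vsubmxK z); move: (usubmx z) (dsubmx z).
  move=> {z} x y; rewrite mul_block_col mul0mx addr0 -col_mx0.
  move=> /eq_col_mx[Mx My].
  rewrite mul_row_col mul0mx add0r.
  pose w := \sum_i x i 0 *: e i; pose q := \sum_j y j 0 *: g j.
  have Vw : V w by exact: Vsum.
  have Qq : Q q by exact: Qsum.
  have aw i : a (e i) w + b (e i) q = 0.
    rewrite (linear_on_sum VV (ar _ (Ve i)))// (linear_on_sum QQ (br _ (Ve i)))//.
    have /matrixP/(_ i 0) := Mx; rewrite !mxE => h; rewrite -[RHS]h.
    by congr (_ + _); apply: eq_bigr => k _; rewrite !mxE mulrC.
  have bw j : b w (g j) = 0.
    rewrite (linear_on_sum VV (bl _ (Qg j)))//.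
    have /matrixP/(_ j 0) := My; rewrite !mxE => h; rewrite -[RHS]h.
    by apply: eq_bigr => k _; rewrite !mxE mulrC.
  have bwq : b w q = 0.
    by rewrite (linear_on_sum QQ (br _ Vw))// big1// => j _; rewrite bw mulr0.
  have ab u : V u -> a u w + b u q = 0.
    move=> Vu; have [c [ca cb]] := spanV _ Vu.
    rewrite ca// cb// (linear_on_sum VV (al _ Vw))// (linear_on_sum VV (bl _ Qq))//.
    by rewrite -big_split big1//= => i _; rewrite -mulrDr aw mulr0.
  have aww : a w w = 0 by have := ab _ Vw; rewrite bwq addr0.
  have bq u : V u -> b u q = 0.
    move=> Vu; have := cauchy_schwarz VV aV a_sym a_ge0 Vu Vw.
    rewrite aww mulr0 real_exprn_even_le0 ?num_real//= => /eqP auw.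
    by have := ab _ Vu; rewrite auw add0r.
  apply/matrixP => i j; rewrite !ord1 [RHS]mxE -(bq _ Vv).
  rewrite (linear_on_sum QQ (br _ Vv))// mxE.
  by apply: eq_bigr => k _; rewrite !mxE mulrC.
rewrite -(hsubmxK x); move: (lsubmx x) (rsubmx x) => {}x y.
rewrite mul_row_block mulmx0 addr0 => /eqP/eq_row_mx[xA xB].
(* The second block of the solution represents -p, hence the sign. *)
pose z := \sum_i x 0 i *: e i; pose p := \sum_j - y 0 j *: g j.
have Vz : V z by exact: Vsum.
have Qp : Q p by exact: Qsum.
have az i : a (e i) z = b (e i) p.
  rewrite (linear_on_sum VV (ar _ (Ve i)))// (linear_on_sum QQ (br _ (Ve i)))//.
  have /matrixP/(_ 0 i) := xA; rewrite !mxE => /eqP.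
  rewrite eq_sym addr_eq0 -sumrN => /eqP.
  under eq_bigr do rewrite mxE (a_sym (Ve _) (Ve i)).
  by move=> ->; apply: eq_bigr => j _; rewrite !mxE mulNr.
have bz j : b z (g j) = b v (g j).
  rewrite (linear_on_sum VV (bl _ (Qg j)))//.
  have /matrixP/(_ 0 j) := xB; rewrite !mxE => ->.
  by apply: eq_bigr => k _; rewrite !mxE.
exists z, p; split => // [u Vu|q Qq].
  have [c [ca cb]] := spanV _ Vu.
  rewrite a_sym// ca// cb// (linear_on_sum VV (al _ Vz))//.
  rewrite (linear_on_sum VV (bl _ Qp))//.
  by apply: eq_bigr => i _; rewrite az.
have [c cb] := spanQ _ Qq.
rewrite !cb// !(linear_on_sum QQ (br _ _))//.
by apply: eq_bigr => j _; rewrite bz.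
Qed.

End SaddlePoint.

(** * The abstract stability estimate *)

Section SaddleEstimate.
Context {R : realType} {E F : lmodType R}.
Variables (V : set E) (Q : set F) (a : E -> E -> R) (b : E -> F -> R).
Variables (nV : E -> R) (nQ : F -> R) (alpha beta gamma : R).
Hypothesis VV : linear_subspace V.
Hypotheses (aV : bilinear_on V V a) (bVQ : bilinear_on V Q b).
Hypothesis a_sym : forall u v, V u -> V v -> a u v = a v u.
Hypothesis projection : forall v, V v -> exists z p,
  [/\ V z, Q p, forall u, V u -> a z u = b u p &
      forall q, Q q -> b z q = b v q].
Hypothesis nV_ge0 : forall v, 0 <= nV v.
Hypothesis nV_triangle : forall u v, V u -> V v -> nV (u + v) <= nV u + nV v.
Hypotheses (alpha_gt0 : 0 < alpha) (beta_gt0 : 0 < beta) (gamma_ge0 : 0 <= gamma).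
Hypothesis coercive : forall v, V v -> alpha * nV v ^+ 2 <= a v v.
Hypothesis continuous_a : forall v, V v -> a v v <= gamma * nV v ^+ 2.
Hypothesis inf_sup_b : forall q C, Q q -> 0 <= C ->
  (forall v, V v -> b v q <= C * nV v) -> beta * nQ q <= C.

Let nA v := Num.sqrt (a v v).

Let a_ge0 v : V v -> 0 <= a v v.
Proof.
by move=> Vv; apply: le_trans (coercive Vv); rewrite mulr_ge0 ?sqr_ge0// ltW.
Qed.

Let nV_le v : V v -> nV v <= nA v / Num.sqrt alpha.
Proof.
move=> Vv; rewrite ler_pdivlMr ?sqrtr_gt0// mulrC.
have -> : nV v = Num.sqrt (nV v ^+ 2) by rewrite sqrtr_sqr ger0_norm.
by rewrite /nA -sqrtrM ?(ltW alpha_gt0)// ler_wsqrtr// coercive.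
Qed.

Let nA_le v : V v -> nA v <= Num.sqrt gamma * nV v.
Proof.
move=> Vv; have -> : nV v = Num.sqrt (nV v ^+ 2) by rewrite sqrtr_sqr ger0_norm.
by rewrite /nA -sqrtrM// ler_wsqrtr// continuous_a.
Qed.

(** The inf-sup condition enters as the implication [inf_sup_b], so [beta] may be any positive
    number for which it holds; this freedom is what later handles a trivial pressure space. *)
Lemma saddle_estimate e p r1 r2 : V e -> Q p -> 0 <= r1 -> 0 <= r2 ->
  (forall v, V v -> a e v + b v p <= r1 * nV v) ->
  (forall q, Q q -> b e q <= r2 * nQ q) ->
  nV e <= alpha^-1 * r1 + beta^-1 * Num.sqrt (gamma / alpha) * r2 /\
  nQ p <= beta^-1 * Num.sqrt (gamma / alpha) * r1 + gamma / beta ^+ 2 * r2.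
Proof.
move=> Ve Qp r1_ge0 r2_ge0 res1 res2.
have [al ar] := aV; have [bl br] := bVQ.
have cs := cauchy_schwarz_sqrt VV aV a_sym a_ge0.
have nA_ge0 v : 0 <= nA v by exact: sqrtr_ge0.
have beta_inv : 0 <= beta^-1 by rewrite invr_ge0 ltW.
have sg_ge0 : 0 <= Num.sqrt gamma by exact: sqrtr_ge0.
have csA u v : V u -> V v -> a u v <= nA u * nA v.
  by move=> Vu Vv; apply: le_trans (cs _ _ Vu Vv); exact: ler_norm.
have sqA v : V v -> a v v = nA v ^+ 2 by move=> Vv; rewrite sqr_sqrtr ?a_ge0.
(* [e1] is Pe and [p1] is the p' with a(Pe, .) = b(., p'). *)
have [e1 [p1 [Ve1 Qp1 ae1 be1]]] := projection Ve.
(* One factor |Pe|_a is cancelled in |Pe|_a^2 = b(e, p1) <= r2 |p1|. The inf-sup condition with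
   constant |Pe|_a sqrt(gamma) bounds |p1|. *)
have a1 : nA e1 <= beta^-1 * Num.sqrt gamma * r2.
  have [->|nz] := eqVneq (nA e1) 0; first by rewrite !mulr_ge0.
  have n_gt0 : 0 < nA e1 by rewrite lt_neqAle eq_sym nz nA_ge0.
  rewrite -(ler_pM2l n_gt0) -expr2 -sqA// ae1// be1//.
  apply: le_trans (res2 _ Qp1) _.
  have -> : nA e1 * (beta^-1 * Num.sqrt gamma * r2) =
            r2 * (beta^-1 * (nA e1 * Num.sqrt gamma)) by ring.
  apply: ler_wpM2l => //; rewrite ler_pdivlMl//.
  apply: inf_sup_b; rewrite ?mulr_ge0// => v Vv; rewrite -ae1// -mulrA.
  by apply: le_trans (csA _ _ Ve1 Vv) _; rewrite ler_wpM2l// nA_le.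
have gae : Num.sqrt (gamma / alpha) = Num.sqrt gamma / Num.sqrt alpha.
  by rewrite sqrtrM// sqrtrV// ltW.
have sa_ge0 : 0 <= (Num.sqrt alpha)^-1 by rewrite invr_ge0 sqrtr_ge0.
pose e0 := e - e1.
have Ve0 : V e0 by exact: linear_subspaceB.
have be0 q : Q q -> b e0 q = 0.
  by move=> Qq; rewrite (linear_onB VV (bl _ Qq))// be1// subrr.
have ae10 : a e1 e0 = 0 by rewrite ae1// be0.
have nV0 : nV e0 <= alpha^-1 * r1.
  rewrite ler_pdivlMl//.
  have [->|nz] := eqVneq (nV e0) 0; first by rewrite mulr0.
  have n_gt0 : 0 < nV e0 by rewrite lt_neqAle eq_sym nz nV_ge0.
  rewrite -(ler_pM2r n_gt0) -mulrA -expr2.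
  apply: le_trans (coercive Ve0) _; apply: le_trans (res1 _ Ve0).
  rewrite be0// addr0 {1}/e0 (linear_onB VV (al _ Ve0))// ae10 subr0.
  exact: lexx.
split.
  have -> : e = e0 + e1 by rewrite subrK.
  apply: le_trans (nV_triangle Ve0 Ve1) _; rewrite lerD//.
  apply: le_trans (nV_le Ve1) _; rewrite gae.
  have -> : beta^-1 * (Num.sqrt gamma / Num.sqrt alpha) * r2 =
            beta^-1 * Num.sqrt gamma * r2 / Num.sqrt alpha by ring.
  by rewrite ler_wpM2r.
have -> : beta^-1 * Num.sqrt (gamma / alpha) * r1 + gamma / beta ^+ 2 * r2 =
  beta^-1 * (Num.sqrt (gamma / alpha) * r1 + gamma / beta * r2).
  by field; rewrite gt_eqF.
rewrite ler_pdivlMl//; apply: inf_sup_b => // [|v Vv].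
  by rewrite addr_ge0 ?mulr_ge0 ?sqrtr_ge0.
have [v1 [q [Vv1 Qq av1 bv1]]] := projection Vv.
(* v1 is the a-orthogonal projection of v on the complement of ker b *)
have nA1 : nA v1 <= nA v.
  have Vv0 : V (v - v1) by exact: linear_subspaceB.
  have a10 : a v1 (v - v1) = 0.
    by rewrite av1// (linear_onB VV (bl _ Qq))// bv1// subrr.
  have a11 : a v1 v1 = a v1 v.
    by move: a10; rewrite (linear_onB VV (ar _ Vv1))// => /eqP;
      rewrite subr_eq0 => /eqP.
  have [->//|nz] := eqVneq (nA v1) 0.
  have n_gt0 : 0 < nA v1 by rewrite lt_neqAle eq_sym nz nA_ge0.
  by rewrite -(ler_pM2l n_gt0) -expr2 -sqA// a11 csA.
have nA2 : nA v1 <= Num.sqrt gamma * nV v by exact: le_trans nA1 (nA_le Vv).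
(* [e0] and [v1] are a-orthogonal, since a(v1, .) = b(., q) and b(e0, .) = 0. *)
have ev1 : a e v1 = a e1 v1.
  have e0v1 : a e0 v1 = 0 by rewrite a_sym// av1// be0.
  by move: e0v1; rewrite (linear_onB VV (al _ Vv1))// => /eqP;
    rewrite subr_eq0 => /eqP.
rewrite -bv1//.
have -> : b v1 p = (a e v1 + b v1 p) - a e1 v1 by rewrite ev1 addrC addKr.
rewrite mulrDl lerD//.
  apply: le_trans (res1 _ Vv1) _; rewrite gae.
  have -> : Num.sqrt gamma / Num.sqrt alpha * r1 * nV v =
     r1 * (Num.sqrt gamma * nV v / Num.sqrt alpha) by ring.
  rewrite ler_wpM2l//; apply: le_trans (nV_le Vv1) _.
  by rewrite ler_wpM2r.
(* In |a(e1, v1)| <= |e1|_a |v1|_a each factor contributes one sqrt(gamma). *)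
apply: le_trans (ler_norm _) _; rewrite normrN; apply: le_trans (cs _ _ Ve1 Vv1) _.
have -> : gamma / beta * r2 * nV v =
  beta^-1 * Num.sqrt gamma * r2 * (Num.sqrt gamma * nV v).
  by rewrite -[in LHS](sqr_sqrtr gamma_ge0) expr2; ring.
by rewrite ler_pM.
Qed.

End SaddleEstimate.

(** * Open sets are Lebesgue measurable *)

Section OpenMeasurable.
Context {R : realType} {d : nat}.

Let leb : {outer_measure set 'rV[R]_d -> \bar R} := @lebesgue_outer R d.

Definition halfspace (i : 'I_d) (c : R) : set 'rV[R]_d := [set x | x 0 i <= c].

(** The hyperplane x_i = c cuts a box around [A] into a box around each part, and the two volumes
    add up. Empty parts come first, their gauge being 0 by definition. *)
Lemma box_gauge_halfspace i c (A : set 'rV[R]_d) :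
  (box_gauge (A `&` halfspace i c) + box_gauge (A `&` ~` halfspace i c) <=
   box_gauge A)%E.
Proof.
have [A0|/set0P[x [Ax xc]]] := eqVneq (A `&` halfspace i c) set0.
  rewrite A0 box_gauge0 add0e (_ : A `&` _ = A)//.
  by apply: setIidl => x Ax xc; have : set0 x by rewrite -A0; split.
have [A0|/set0P[y [Ay yc]]] := eqVneq (A `&` ~` halfspace i c) set0.
  rewrite A0 box_gauge0 adde0 (_ : A `&` _ = A)//.
  by apply: setIidl => z Az; apply: contrapT => zc; have : set0 z by rewrite -A0; split.
move: yc; rewrite /halfspace/= => /negP; rewrite -ltNge => yc.
have gaugeE B z : B z -> box_gauge B = ereal_inf [set (\prod_i (p.2 0 i - p.1 0 i))%:E |
              p in [set p : 'rV[R]_d * 'rV[R]_d | B `<=` box p.1 p.2]].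
  by rewrite /box_gauge; case: eqP => // ->.
rewrite (gaugeE A x)//; apply: le_ereal_inf_tmp => _ [[a b] /= Aab <-].
have /andP[ax _] := Aab _ Ax i.
have /andP[_ yb] := Aab _ Ay i.
(* The two pieces of the box are (a, [upd b]) and ([upd a], b). *)
pose upd (u : 'rV[R]_d) : 'rV[R]_d := \row_j if j == i then c else u 0 j.
have -> : \prod_j (b 0 j - a 0 j) = \prod_j (upd b 0 j - a 0 j) +
    \prod_j (b 0 j - upd a 0 j).
  have prodD1 (u v : 'rV[R]_d) : \prod_j (u 0 j - v 0 j) =
      (u 0 i - v 0 i) * \prod_(j < d | j != i) (u 0 j - v 0 j).
    by rewrite (bigD1 i).
  rewrite !prodD1 !mxE eqxx.
  have eqp u v : \prod_(j < d | j != i) (upd u 0 j - v 0 j) = \prod_(j < d | j != i) (u 0 j - v 0 j).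
    by apply: eq_bigr => j /negPf ji; rewrite mxE ji.
  have eqp' u v : \prod_(j < d | j != i) (u 0 j - upd v 0 j) = \prod_(j < d | j != i) (u 0 j - v 0 j).
    by apply: eq_bigr => j /negPf ji; rewrite mxE ji.
  by rewrite eqp eqp' -mulrDl; congr (_ * _); ring.
rewrite EFinD leeD//.
  rewrite (gaugeE _ x)//; apply: ereal_inf_lbound; exists (a, upd b) => //= z [Az zc] j.
  by rewrite mxE; case: eqP => [->|_]; have := Aab _ Az; [move=> /(_ i)/andP[-> _]|].
rewrite (gaugeE _ y)//; last by split=> //; apply/negP; rewrite -ltNge.
apply: ereal_inf_lbound; exists (upd a, b) => //= z [Az /negP zc] j.
rewrite mxE; case: eqP => [->|_]; have := Aab _ Az; last exact.
by move=> /(_ i)/andP[_ ->]; rewrite andbT ltNge.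
Qed.

(** The Caratheodory criterion is inherited from the gauge: splitting every member of a cover of [X]
    yields covers of both parts of [X] with no larger total gauge. *)
Lemma halfspace_measurable i c : leb.-cara.-measurable (halfspace i c).
Proof.
apply: le_caratheodory_measurable => X.
apply: le_ereal_inf_tmp => _ [F XF <-].
apply: le_trans (_ : (\sum_(k <oo) (box_gauge (F k `&` halfspace i c)%classic) +
  \sum_(k <oo) (box_gauge (F k `&` ~` halfspace i c)%classic) <= _)%E).
  apply: leeD; apply: ereal_inf_lbound.
    by exists (fun k => F k `&` halfspace i c) => //; rewrite /= -setI_bigcupl; exact: setSI.
  by exists (fun k => F k `&` ~` halfspace i c) => //; rewrite /= -setI_bigcupl; exact: setSI.
rewrite -nneseriesD//; try by move=> *; exact: box_gauge_ge0.
apply: lee_nneseries => [k _ _|k _]; first by rewrite adde_ge0 ?box_gauge_ge0.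
exact: box_gauge_halfspace.
Qed.

Lemma box_measurable (a b : 'rV[R]_d) : leb.-cara.-measurable (box a b).
Proof.
rewrite (_ : box a b = \bigcap_i (halfspace i (b 0 i) `\` halfspace i (a 0 i))).
  apply: fin_bigcap_measurable => // i _.
  by apply: measurableD; exact: halfspace_measurable.
apply/seteqP; split=> [x xab i _|x xab i].
  by have /andP[ax xb] := xab i; split => //; apply/negP; rewrite -ltNge.
by have [xb /negP] := xab i I; rewrite -ltNge => ax; rewrite ax.
Qed.

(** An open set is the countable union of the half-open boxes with rational corners that it
    contains; [B] enumerates them through [unpickle]. This makes integration over the domain
    additive. *)
Lemma open_lebesgue_measurable (D : set 'rV[R]_d) :
  open D -> leb.-cara.-measurable D.
Proof.
move=> oD.
pose ratv (v : 'rV[rat]_d) : 'rV[R]_d := map_mx ratr v.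
pose B n : set 'rV[R]_d :=
  if @unpickle ('rV[rat]_d * 'rV[rat]_d)%type n is Some p then
    if `[< box (ratv p.1) (ratv p.2) `<=` D >] then box (ratv p.1) (ratv p.2)
    else set0
  else set0.
rewrite (_ : D = \bigcup_n B n).
  apply: bigcupT_measurable => n; rewrite /B.
  case: unpickle => [p|]; last exact: measurable0.
  by case: ifP => _; [exact: box_measurable|exact: measurable0].
apply/seteqP; split=> [x Dx|x [n _]]; last first.
  by rewrite /B; case: unpickle => // p; case: ifPn => // /asboolP; exact.
have /nbhs_ballP[e e0 eD] : nbhs x D by exact: open_nbhs_nbhs.
(* Balls of row vectors are taken in the sup norm, so the corners can be chosen one coordinate at a
   time, within e on either side of x. *)
have ex i : exists pq : rat * rat, x 0 i - e < ratr pq.1 < x 0 i /\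
    x 0 i < ratr pq.2 < x 0 i + e.
  have [|p] := @rat_in_itvoo R (x 0 i - e) (x 0 i).
    by rewrite ltrBlDr ltrDl.
  rewrite in_itv => p_in.
  have [|q] := @rat_in_itvoo R (x 0 i) (x 0 i + e).
    by rewrite ltrDl.
  by rewrite in_itv => q_in; exists (p, q).
have [pq pqP] := choice ex.
pose p : 'rV[rat]_d * 'rV[rat]_d := (\row_i (pq i).1, \row_i (pq i).2).
exists (pickle p) => //; rewrite /B pickleK.
rewrite asboolT; last first.
  move=> y yp; apply: eD; split => // i j; rewrite ord1 {i}.
  have [/andP[p1 p2] /andP[q1 q2]] := pqP j.
  have := yp j; rewrite !mxE => /andP[y1 y2].
  rewrite /ball/= ltr_norml ltrBrDr ltrBlDr; apply/andP; split; lra.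
move=> i; rewrite !mxE.
by have [/andP[p1 p2] /andP[q1 q2]] := pqP i; rewrite p2 ltW.
Qed.

End OpenMeasurable.

(** * Square integrable functions *)

Section SquareIntegrable.
Context {R : realType} {disp : measure_display} {T : measurableType disp}.
Variables (mu : {measure set T -> \bar R}) (D : set T).
Hypothesis mD : measurable D.
Implicit Types f g h : T -> R.

Local Notation Int f := (mu.-integrable D (EFin \o f)).

Lemma integrable_lin (c : R) f g :
  Int f -> Int g -> Int (fun x => c * f x + g x).
Proof.
move=> If Ig; have := integrableD mD (integrableZl mD c If) Ig.
by apply: eq_integrable => // x _.
Qed.

Lemma integrable_Rsum n (h : 'I_n -> T -> R) :
  (forall i, Int (h i)) -> Int (fun x => \sum_i h i x).
Proof.
move=> Ih; have := integrable_sum mD (index_enum 'I_n) (P := xpredT)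
  (h := fun i => EFin \o h i) (fun i _ => Ih i).
by apply: eq_integrable => // x _ /=; rewrite sumEFin.
Qed.

Lemma Rintegral_lin (c : R) f g : Int f -> Int g ->
  \int[mu]_(x in D) (c * f x + g x) =
  c * \int[mu]_(x in D) f x + \int[mu]_(x in D) g x.
Proof.
move=> If Ig; rewrite RintegralD// ?RintegralZl//.
by have := integrableZl mD c If; apply: eq_integrable => // x _.
Qed.

Lemma Rintegral_sum n (h : 'I_n -> T -> R) : (forall i, Int (h i)) ->
  \int[mu]_(x in D) (\sum_i h i x) = \sum_i \int[mu]_(x in D) h i x.
Proof.
elim: n h => [|n IH] h Ih.
  rewrite big_ord0 -[RHS](mul0r (mu D \is a fin_num)%:R).
  by under eq_Rintegral do rewrite big_ord0; rewrite mul0r /Rintegral integral0.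
under eq_Rintegral do rewrite big_ord_recr/=.
by rewrite big_ord_recr/= RintegralD// ?IH//; exact: integrable_Rsum.
Qed.

Lemma Rintegral_ae_eq f g : Int f -> Int g -> ae_eq mu D f g ->
  \int[mu]_(x in D) f x = \int[mu]_(x in D) g x.
Proof.
move=> If Ig fg; rewrite /Rintegral; congr fine.
apply: ae_eq_integral => //; first exact: measurable_int If.
  exact: measurable_int Ig.
by apply: filterS fg => x /= fgx Dx; rewrite fgx.
Qed.

Lemma integrable_bounded_mul f h : bounded_measurable mu D h -> Int f ->
  Int (fun x => h x * f x).
Proof.
move=> [mh [C hC]] If.
have mf : measurable_fun D f by apply/measurable_EFinP; exact: measurable_int If.
apply: (@le_integrable _ _ _ mu D mD _ (EFin \o (fun x => C * f x))).
- exact/measurable_EFinP/measurable_funM.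
- move=> x Dx /=; rewrite lee_fin !normrM ler_wpM2r//.
  exact: le_trans (hC _ Dx) (ler_norm _).
- by have := integrableZl mD C If; apply: eq_integrable => // x _.
Qed.

(** The product is dominated by f^2 + g^2, because (|f| - |g|)^2 >= 0. The factor [1] gives the
    bound the shape of [integrable_lin]. *)
Lemma integrable_L2M f g : L2 mu D f -> L2 mu D g -> Int (fun x => f x * g x).
Proof.
move=> [mf If] [mg Ig].
apply: (@le_integrable _ _ _ mu D mD _
  (EFin \o (fun x => 1 * f x ^+ 2 + g x ^+ 2))).
- exact/measurable_EFinP/measurable_funM.
- move=> x Dx /=; rewrite lee_fin mul1r.
  rewrite [leRHS]ger0_norm ?addr_ge0 ?sqr_ge0//.
  rewrite normrM -(real_normK (num_real (f x))) -(real_normK (num_real (g x))).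
  have := sqr_ge0 (`|f x| - `|g x|).
  have := normr_ge0 (f x); have := normr_ge0 (g x).
  move: `|f x| `|g x| => a b; nra.
- exact: integrable_lin.
Qed.

Lemma L2_linear_subspace : linear_subspace [set f | L2 mu D f].
Proof.
split=> [|c f g L2f L2g] /=.
  split; first exact: measurable_cst.
  rewrite (_ : (fun _ => _) = cst 0%E); first exact: integrable0.
  by apply/funext => x; rewrite /= expr0n.
have [[mf If] [mg Ig]] := (L2f, L2g); split.
  by apply: measurable_funD => //; apply: measurable_funM.
have Ifg := integrable_L2M L2f L2g.
have := integrable_lin 1 (integrable_lin (c ^+ 2) If Ig) (integrable_lin (2 * c) Ifg
  (integrable0 mu D)).
apply: eq_integrable => //; move=> x _ /=; congr (_%:E).
have -> : (c *: f + g) x = c * f x + g x by [].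
by ring.
Qed.

Definition L2_form f g : R := \int[mu]_(x in D) (f x * g x).

Lemma L2_formC f g : L2_form f g = L2_form g f.
Proof. by apply: eq_Rintegral => x _; rewrite mulrC. Qed.

Lemma L2_form_bilinear :
  bilinear_on [set f | L2 mu D f] [set f | L2 mu D f] L2_form.
Proof.
have lin g : L2 mu D g -> linear_on [set f | L2 mu D f] (L2_form ^~ g).
  move=> L2g c f f' L2f L2f'.
  rewrite /L2_form -Rintegral_lin; try exact: integrable_L2M.
  by apply: eq_Rintegral => x _; rewrite mulrA -mulrDl.
split=> // f L2f c g g' L2g L2g'; rewrite L2_formC lin//.
by rewrite !(L2_formC _ f).
Qed.

Lemma L2_form_ge0 f : 0 <= L2_form f f.
Proof. by apply: Rintegral_ge0 => x _; rewrite -expr2 sqr_ge0. Qed.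

Lemma L2_cauchy_schwarz f g : L2 mu D f -> L2 mu D g ->
  `|\int[mu]_(x in D) (f x * g x)| <=
  Num.sqrt (\int[mu]_(x in D) (f x ^+ 2)) * Num.sqrt (\int[mu]_(x in D) (g x ^+ 2)).
Proof.
move=> L2f L2g.
exact: (cauchy_schwarz_sqrt L2_linear_subspace L2_form_bilinear
  (fun u v _ _ => L2_formC u v) (fun u _ => L2_form_ge0 u) L2f L2g).
Qed.

End SquareIntegrable.

(** * The Stokes-Brinkman forms *)

Section Forms.
Context {R : realType} {d : nat}.
Variable D : set 'rV[R]_d.
Hypothesis oD : open D.
Implicit Types (u v : field R d) (q : 'rV[R]_d -> R).

Local Notation mu := (lebesgue R d).
Local Notation Int f := (mu.-integrable D (EFin \o f)).

Let mD : measurable (D : set (caratheodory_type (@lebesgue_outer R d))).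
Proof. exact: open_lebesgue_measurable. Qed.

Definition grad_dot u v (x : 'rV[R]_d) : R :=
  \sum_i \sum_j grad u x i j * grad v x i j.

Lemma grad_dotC u v : grad_dot u v = grad_dot v u.
Proof.
apply/funext => x; apply: eq_bigr => i _; apply: eq_bigr => j _.
by rewrite mulrC.
Qed.

Lemma grad_dot_lin c u u' v x :
  grad_dot (c *: u + u') v x = c * grad_dot u v x + grad_dot u' v x.
Proof.
rewrite /grad_dot mulr_sumr -big_split/=; apply: eq_bigr => i _.
rewrite mulr_sumr -big_split/=; apply: eq_bigr => j _.
have -> : grad (c *: u + u') x i j = c * grad u x i j + grad u' x i j.
  by rewrite [LHS]mxE [X in X + _]mxE.
by rewrite mulrDl mulrA.
Qed.

Lemma grad_dot_integrable u v : H1 D u -> H1 D v -> Int (grad_dot u v).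
Proof.
move=> [_ Gu _] [_ Gv _]; apply: integrable_Rsum => // i.
by apply: integrable_Rsum => // j; exact: integrable_L2M.
Qed.

Lemma div_lin c u v x : div (c *: u + v) x = c * div u x + div v x.
Proof. by rewrite /div -mxtraceZ -mxtraceD. Qed.

Lemma mul_div_integrable q v : Qspace D q -> H1 D v ->
  Int (fun x => q x * div v x).
Proof.
move=> Qq [_ Gv _].
rewrite (_ : (fun _ => _) = fun x => \sum_i q x * grad v x i i).
  by apply: integrable_Rsum => // i; exact: integrable_L2M.
by apply/funext => x; rewrite mulr_sumr.
Qed.

Lemma innerVE u v : innerV D u v = \int[mu]_(x in D) grad_dot u v x.
Proof. by []. Qed.

Lemma innerVC u v : innerV D u v = innerV D v u.
Proof. by rewrite !innerVE grad_dotC. Qed.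

Lemma innerV_ge0 v : 0 <= innerV D v v.
Proof.
apply: Rintegral_ge0 => x _; apply: sumr_ge0 => i _; apply: sumr_ge0 => j _.
by rewrite -expr2 sqr_ge0.
Qed.

Lemma innerV_bilinear V : linear_subspace V -> V `<=` H1 D ->
  bilinear_on V V (@innerV _ _ D).
Proof.
move=> VV VH; apply: linear_on_sym => // [u v _ _|]; first exact: innerVC.
move=> v /VH Hv c u u' /VH Hu /VH Hu'.
rewrite !innerVE -Rintegral_lin//; try exact: grad_dot_integrable.
by apply: eq_Rintegral => x _; rewrite grad_dot_lin.
Qed.

Lemma normVN v : normV D (- v) = normV D v.
Proof.
rewrite /normV; congr Num.sqrt; apply: eq_Rintegral => x _.
apply: eq_bigr => i _; apply: eq_bigr => j _.
have -> : grad (- v) x i j = - grad v x i j by rewrite [LHS]mxE.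
by rewrite mulrNN.
Qed.

Lemma normQN q : normQ D (- q) = normQ D q.
Proof.
rewrite /normQ; congr Num.sqrt; apply: eq_Rintegral => x _.
by rewrite -[LHS](sqrrN (- q x))// opprK.
Qed.

Lemma bform_bilinear V Q : V `<=` H1 D -> Q `<=` Qspace D ->
  bilinear_on V Q (@bform _ _ D).
Proof.
move=> VH QH; split=> [q /QH Qq c u v /VH Hu /VH Hv|v /VH Hv c p q /QH Qp /QH Qq];
  rewrite /bform mulrN -opprD; congr (- _);
  rewrite -Rintegral_lin//; try exact: mul_div_integrable;
  apply: eq_Rintegral => x _.
  by rewrite div_lin mulrDr mulrCA.
have -> : (c *: p + q) x = c * p x + q x by [].
by rewrite mulrDl mulrA.
Qed.

(** Each of the d diagonal entries of the gradient has L^2 norm at most that of the whole gradient.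
    The crude factor d is harmless: the bound serves to show that dual norms and the inf-sup
    constant are finite. *)
Lemma bform_le v q : H1 D v -> Qspace D q ->
  `|bform D v q| <= d%:R * (normV D v * normQ D q).
Proof.
move=> Hv Qq; have [_ Gv _] := Hv.
rewrite /bform normrN.
have -> : \int[mu]_(x in D) (q x * div v x) =
    \sum_i \int[mu]_(x in D) (q x * grad v x i i).
  rewrite -Rintegral_sum// => [|i]; last exact: integrable_L2M.
  by apply: eq_Rintegral => x _; rewrite mulr_sumr.
apply: le_trans (ler_norm_sum _ _ _) _.
have -> : d%:R * (normV D v * normQ D q) = \sum_(i < d) normV D v * normQ D q.
  by rewrite sumr_const card_ord mulr_natl.
apply: ler_sum => i _.
apply: le_trans (L2_cauchy_schwarz mD Qq (Gv i i)) _.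
rewrite mulrC ler_wpM2r ?sqrtr_ge0// ler_wsqrtr//.
apply: le_Rintegral => //; first by have [] := Gv i i.
  exact: grad_dot_integrable.
move=> x _; rewrite /grad_dot (bigD1 i)//= (bigD1 i)//= -expr2 -addrA lerDl.
rewrite addr_ge0 ?sumr_ge0// => j _; first by rewrite -expr2 sqr_ge0.
by rewrite sumr_ge0// => k _; rewrite -expr2 sqr_ge0.
Qed.

(** Finite dimension and being nonzero are understood up to null sets. This lemma and its companions
    let forms and norms pass to such classes. *)
Lemma bform_ael u v q : H1 D u -> H1 D v -> Qspace D q -> H1_eq D u v ->
  bform D u q = bform D v q.
Proof.
move=> Hu Hv Qq [_ uv]; rewrite /bform; congr (- _).
apply: Rintegral_ae_eq => //; try exact: mul_div_integrable.
by apply: filterS uv => x /= uvx Dx; rewrite /div uvx.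
Qed.

Lemma bform_aer v p q : H1 D v -> Qspace D p -> Qspace D q -> Q_eq D p q ->
  bform D v p = bform D v q.
Proof.
move=> Hv Qp Qq pq; rewrite /bform; congr (- _).
apply: Rintegral_ae_eq => //; try exact: mul_div_integrable.
by apply: filterS pq => x /= pqx Dx; rewrite pqx.
Qed.

Lemma normV_ae u v : H1 D u -> H1 D v -> H1_eq D u v -> normV D u = normV D v.
Proof.
move=> Hu Hv [_ uv]; rewrite /normV; congr Num.sqrt.
apply: Rintegral_ae_eq => //; try exact: grad_dot_integrable.
by apply: filterS uv => x /= uvx Dx; rewrite uvx.
Qed.

Lemma normQ_ae p q : Qspace D p -> Qspace D q -> Q_eq D p q ->
  normQ D p = normQ D q.
Proof.
move=> [_ Ip] [_ Iq] pq; rewrite /normQ; congr Num.sqrt.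
apply: Rintegral_ae_eq => //.
by apply: filterS pq => x /= pqx Dx; rewrite pqx.
Qed.

(** * The form a: viscous part and drag *)

Section Brinkman.
Variables (nu : 'rV[R]_d -> R) (K : 'rV[R]_d -> 'M[R]_d).
Hypotheses (nuP : viscosity D nu) (KP : permeability D K).

Definition drag u v (x : 'rV[R]_d) : R :=
  (u.1 x *m (invmx (K x) *m (v.1 x)^T)) 0 0.

Lemma dragE u v x :
  drag u v x = \sum_i \sum_j invmx (K x) i j * (u.1 x 0 i * v.1 x 0 j).
Proof.
rewrite /drag mxE; apply: eq_bigr => i _; rewrite mxE mulr_sumr.
by apply: eq_bigr => j _; rewrite !mxE mulrCA.
Qed.

Lemma dragC u v x : D x -> drag u v x = drag v u x.
Proof.
move=> Dx; have [_ Ksym _] := KP.1 _ Dx.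
rewrite /drag -[in LHS](trmxK (_ *m (_ *m _))) [LHS]mxE !trmx_mul trmxK.
by rewrite trmx_inv Ksym mulmxA.
Qed.

Lemma drag_lin c u u' v x : drag (c *: u + u') v x = c * drag u v x + drag u' v x.
Proof.
have -> : drag (c *: u + u') v x =
  ((c *: u.1 x + u'.1 x) *m (invmx (K x) *m (v.1 x)^T)) 0 0 by [].
by rewrite mulmxDl -scalemxAl mxE [X in X + _]mxE.
Qed.

Lemma drag_integrable u v : H1 D u -> H1 D v -> Int (drag u v).
Proof.
move=> [Lu _ _] [Lv _ _].
rewrite (_ : drag u v =
  fun x => \sum_i \sum_j invmx (K x) i j * (u.1 x 0 i * v.1 x 0 j)).
  apply: integrable_Rsum => // i; apply: integrable_Rsum => // j.
  apply: integrable_bounded_mul => //; first exact: KP.2.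
  exact: integrable_L2M.
by apply/funext => x; exact: dragE.
Qed.

Lemma nu_grad_dot_integrable u v : H1 D u -> H1 D v ->
  Int (fun x => nu x * grad_dot u v x).
Proof.
move=> Hu Hv; apply: integrable_bounded_mul => //; first exact: nuP.1.
exact: grad_dot_integrable.
Qed.

Lemma aformE u v : aform D nu K u v =
  \int[mu]_(x in D) (nu x * grad_dot u v x) + \int[mu]_(x in D) drag u v x.
Proof. by []. Qed.

Lemma aformC u v : aform D nu K u v = aform D nu K v u.
Proof.
rewrite !aformE grad_dotC; congr (_ + _); apply: eq_Rintegral => x.
by rewrite inE => /dragC.
Qed.

Lemma aform_bilinear V : linear_subspace V -> V `<=` H1 D ->
  bilinear_on V V (aform D nu K).
Proof.
move=> VV VH; apply: linear_on_sym => // [u v _ _|]; first exact: aformC.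
move=> v /VH Hv c u u' /VH Hu /VH Hu'.
rewrite !aformE mulrDr addrACA -!Rintegral_lin//;
  try exact: nu_grad_dot_integrable; try exact: drag_integrable.
by congr (_ + _); apply: eq_Rintegral => x _;
  [rewrite grad_dot_lin mulrDr mulrCA|rewrite drag_lin].
Qed.

Lemma aform_ae u v w : H1 D u -> H1 D v -> H1 D w -> H1_eq D u v ->
  aform D nu K u w = aform D nu K v w.
Proof.
move=> Hu Hv Hw [uv1 uv2]; rewrite !aformE; congr (_ + _);
  apply: Rintegral_ae_eq => //;
  try exact: nu_grad_dot_integrable; try exact: drag_integrable.
  by apply: filterS uv2 => x /= uvx Dx; rewrite /grad_dot uvx.
by apply: filterS uv1 => x /= uvx Dx; rewrite /drag uvx.
Qed.

End Brinkman.

End Forms.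

(** * Error bounds *)

Section DualNorm.
Context {R : realType} {E : lmodType R}.
Variables (eqE : E -> E -> Prop) (norm : E -> R) (S : set E).

Lemma eq_dual_norm (l l' : E -> R) : (forall v, S v -> l v = l' v) ->
  dual_norm eqE norm S l = dual_norm eqE norm S l'.
Proof.
move=> ll'; rewrite /dual_norm; congr ereal_sup.
by apply: eq_imagel => v [Sv _]; rewrite ll'.
Qed.

(** The supremum of the empty family is -oo, which [fine] sends to 0. *)
Lemma dual_norm_trivial l : nonzero eqE S = set0 ->
  fine (dual_norm eqE norm S l) = 0.
Proof. by move=> S0; rewrite /dual_norm S0 image_set0 ereal_sup0. Qed.

Hypothesis SS : linear_subspace S.
Hypothesis eqE_opp : forall v, eqE (- v) 0 -> eqE v 0.
Hypothesis norm_ge0 : forall v, 0 <= norm v.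
Hypothesis norm_gt0 : forall v, nonzero eqE S v -> 0 < norm v.
Hypothesis normN : forall v, norm (- v) = norm v.

(** [C] serves to exclude the value +oo, and a nonzero element excludes -oo, so [fine] returns the
    true supremum. With no nonzero element, [lnull] makes both sides 0. *)
Lemma dual_norm_ub (l : E -> R) (C : R) : linear_on S l ->
  (forall v, S v -> eqE v 0 -> l v = 0) ->
  (forall v, S v -> l v <= C * norm v) ->
  let rho := fine (dual_norm eqE norm S l) in
  0 <= rho /\ forall v, S v -> l v <= rho * norm v.
Proof.
move=> lS lnull lC rho.
have [S0|/set0P[v0 nzv0]] := eqVneq (nonzero eqE S) set0.
  have rho0 : rho = 0 by exact: dual_norm_trivial.
  split=> [|v Sv]; first by rewrite rho0.
  rewrite rho0 mul0r lnull//; apply: contrapT => nv.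
  by have : set0 v by rewrite -S0.
have nz_ub v : nonzero eqE S v -> ((l v / norm v)%:E <= dual_norm eqE norm S l)%E.
  by move=> nv; apply: ereal_sup_ubound; exists v.
have rhoE : dual_norm eqE norm S l = rho%:E.
  rewrite fineK// fin_numE; apply/andP; split.
    by rewrite gt_eqF// (lt_le_trans _ (nz_ub _ nzv0))// ltNyr.
  rewrite lt_eqF// (@le_lt_trans _ _ C%:E) ?ltry//.
  apply: ge_ereal_sup => _ [v nv <-]; rewrite lee_fin ler_pdivrMr ?norm_gt0//.
  by apply: lC; case: nv.
have nz_le v : nonzero eqE S v -> l v / norm v <= rho.
  by move=> nv; rewrite -lee_fin -rhoE nz_ub.
(* The quotients at v0 and -v0 are opposite numbers, and both are at most [rho]. *)
have rho_ge0 : 0 <= rho.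
  have [Sv0 nv0] := nzv0.
  have nzN : nonzero eqE S (- v0).
    by split; [exact: linear_subspaceN|move/eqE_opp].
  have := nz_le _ nzN; have := nz_le _ nzv0.
  rewrite normN (linear_onN SS lS Sv0) mulNr; lra.
split => // v Sv; have [vn|vn] := pselect (eqE v 0).
  by rewrite lnull// mulr_ge0.
have nv : nonzero eqE S v by [].
by rewrite -ler_pdivrMr ?norm_gt0// nz_le.
Qed.

End DualNorm.

(** * Coercivity, continuity and inf-sup constants as inequalities *)

Section Constants.
Context {R : realType} {d : nat}.
Variables (D : set 'rV[R]_d) (nu : 'rV[R]_d -> R) (K : 'rV[R]_d -> 'M[R]_d).
Variables (V : set (field R d)) (Q : set ('rV[R]_d -> R)).

Lemma coercivity_le alpha v : (alpha%:E <= coercivity D nu K V)%E ->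
  nonzero (H1_eq D) V v -> alpha <= aform D nu K v v / normV D v ^+ 2.
Proof.
move=> le nv; rewrite -lee_fin; apply: le_trans le _.
by apply: ereal_inf_lbound; exists v.
Qed.

(* The division convention x / 0 = 0 would put 0 among the Rayleigh quotients,
   so positive coercivity alone makes the seminorm a norm. *)
Lemma coercivity_normV_gt0 alpha v : 0 < alpha ->
  (alpha%:E <= coercivity D nu K V)%E ->
  nonzero (H1_eq D) V v -> 0 < normV D v.
Proof.
move=> alpha_gt0 le nv; rewrite lt_neqAle sqrtr_ge0 andbT eq_sym.
apply/eqP => v0; have := coercivity_le le nv.
by rewrite v0 expr0n/= invr0 mulr0 leNgt alpha_gt0.
Qed.

Lemma continuity_ge gamma v : (continuity D nu K V <= gamma%:E)%E ->
  nonzero (H1_eq D) V v -> aform D nu K v v / normV D v ^+ 2 <= gamma.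
Proof.
move=> le nv; rewrite -lee_fin; apply: le_trans _ le.
by apply: ereal_sup_ubound; exists (v, v) => //; rewrite expr2.
Qed.

(** A nonzero q of norm 0 would turn all its quotients into x / 0 = 0, and the infimum would be at
    most 0. *)
Lemma inf_sup_normQ_gt0 q : (0 < inf_sup D V Q)%E ->
  nonzero (Q_eq D) Q q -> 0 < normQ D q.
Proof.
move=> is_gt0 nq; rewrite lt_neqAle sqrtr_ge0 andbT eq_sym.
apply/eqP => q0; move: is_gt0; rewrite ltNge => /negP; apply.
apply: (@le_trans _ _ (ereal_sup [set (bform D v q / (normQ D q * normV D v))%:E |
  v in nonzero (H1_eq D) V])).
  by apply: ereal_inf_lbound; exists q.
by apply: ge_ereal_sup => _ [v nv <-]; rewrite q0 mul0r invr0 mulr0.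
Qed.

(** Over a trivial [V] the inner supremum is empty, hence -oo, and a single q brings the infimum
    down to -oo. *)
Lemma inf_sup_nonzero q : (0 < inf_sup D V Q)%E ->
  nonzero (Q_eq D) Q q -> nonzero (H1_eq D) V !=set0.
Proof.
move=> is_gt0 nq; apply/set0P/eqP => V0.
suff : (inf_sup D V Q <= -oo)%E.
  by rewrite leeNy_eq => /eqP is0; rewrite is0 in is_gt0.
by apply: ereal_inf_lbound; exists q => //; rewrite V0 image_set0 ereal_sup0.
Qed.

Lemma inf_sup_le q (C : R) : nonzero (Q_eq D) Q q -> 0 < normQ D q ->
  (forall v, nonzero (H1_eq D) V v -> 0 < normV D v) ->
  (forall v, V v -> bform D v q <= C * normV D v) ->
  (inf_sup D V Q <= (C / normQ D q)%:E)%E.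
Proof.
move=> nq q_gt0 V_gt0 bC.
apply: (@le_trans _ _ (ereal_sup [set (bform D v q / (normQ D q * normV D v))%:E |
  v in nonzero (H1_eq D) V])).
  by apply: ereal_inf_lbound; exists q.
apply: ge_ereal_sup => _ [v nv <-]; rewrite lee_fin invfM mulrA [_ / _ / _]mulrAC.
rewrite ler_wpM2r ?invr_ge0 ?(ltW q_gt0)// ler_pdivrMr ?V_gt0//.
by apply: bC; case: nv.
Qed.

End Constants.

Section NullElements.
Context {R : realType} {d : nat}.
Variable D : set 'rV[R]_d.

Lemma H1_eq0N (v : field R d) : H1_eq D (- v) 0 -> H1_eq D v 0.
Proof.
move=> [v1 v2]; split; [apply: filterS v1|apply: filterS v2] => x /= + Dx;
  by move=> /(_ Dx)/(congr1 -%R); rewrite /= opprK oppr0.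
Qed.

Lemma Q_eq0N (q : 'rV[R]_d -> R) : Q_eq D (- q) 0 -> Q_eq D q 0.
Proof.
apply: filterS => x /= + Dx.
by move=> /(_ Dx)/(congr1 -%R); rewrite /= opprK oppr0.
Qed.

End NullElements.

(** * The stability estimate for the Stokes-Brinkman forms *)

Section SaddleErrorBound.
Context {R : realType} {d : nat}.
Variables (D : set 'rV[R]_d) (nu : 'rV[R]_d -> R) (K : 'rV[R]_d -> 'M[R]_d).
Variables (V : set (field R d)) (Q : set ('rV[R]_d -> R)).
Hypotheses (oD : open D) (nuP : viscosity D nu) (KP : permeability D K).
Hypotheses (VH : V `<=` H1 D) (QL : Q `<=` Qspace D).
Hypotheses (VV : linear_subspace V) (QQ : linear_subspace Q).
Hypotheses (Vfin : finite_dimensional (H1_eq D) V)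
  (Qfin : finite_dimensional (Q_eq D) Q).
Hypothesis VQ_inf_sup : (0 < inf_sup D V Q)%E.
Variables (alpha gamma : R).
Hypotheses (alpha_gt0 : 0 < alpha)
  (alpha_le : (alpha%:E <= coercivity D nu K V)%E)
  (gamma_ge : (continuity D nu K V <= gamma%:E)%E).

Local Notation a := (aform D nu K).
Local Notation b := (bform D).

Let V0 : V 0 := VV.1.
Let Q0 : Q 0 := QQ.1.
Let aV := aform_bilinear oD nuP KP VV VH.
Let bVQ := bform_bilinear oD VH QL.
Let a_sym u v : V u -> V v -> a u v = a v u.
Proof. by move=> _ _; exact: aformC. Qed.
Let sV := innerV_bilinear oD VV VH.

Let normV_gt0 v (nv : nonzero (H1_eq D) V v) : 0 < normV D v :=
  coercivity_normV_gt0 alpha_gt0 alpha_le nv.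
Let normQ_gt0 q (nq : nonzero (Q_eq D) Q q) : 0 < normQ D q :=
  inf_sup_normQ_gt0 VQ_inf_sup nq.

Let normV_null v : V v -> H1_eq D v 0 -> normV D v = 0.
Proof.
move=> Vv v0; rewrite (normV_ae oD (VH Vv) (VH V0) v0) /normV.
by rewrite (linear_on0 VV (sV.2 _ V0)) sqrtr0.
Qed.

Let normQ_null q : Q q -> Q_eq D q 0 -> normQ D q = 0.
Proof.
move=> Qq q0; rewrite (normQ_ae oD (QL Qq) (QL Q0) q0) /normQ.
have mD := open_lebesgue_measurable oD.
have L0 := linear_on0 (L2_linear_subspace (lebesgue R d) mD)
  ((L2_form_bilinear (lebesgue R d) mD).2 0 (L2_linear_subspace (lebesgue R d) mD).1).
by rewrite -[X in Num.sqrt X]/(L2_form (lebesgue R d) D 0 0) L0 sqrtr0.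
Qed.

Let a_null u v : V u -> V v -> H1_eq D v 0 -> a u v = 0.
Proof.
move=> Vu Vv v0; rewrite a_sym// (aform_ae oD nuP KP (VH Vv) (VH V0) (VH Vu) v0).
exact: (linear_on0 VV (aV.1 _ Vu)).
Qed.

Let b_nulll v q : V v -> Q q -> H1_eq D v 0 -> b v q = 0.
Proof.
move=> Vv Qq v0; rewrite (bform_ael oD (VH Vv) (VH V0) (QL Qq) v0).
exact: (linear_on0 VV (bVQ.1 _ Qq)).
Qed.

Let b_nullr v q : V v -> Q q -> Q_eq D q 0 -> b v q = 0.
Proof.
move=> Vv Qq q0; rewrite (bform_aer oD (VH Vv) (QL Qq) (QL Q0) q0).
exact: (linear_on0 QQ (bVQ.2 _ Vv)).
Qed.

Let coercive v : V v -> alpha * normV D v ^+ 2 <= a v v.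
Proof.
move=> Vv; have [v0|nv0] := pselect (H1_eq D v 0).
  by rewrite normV_null// expr0n mulr0 a_null.
have nv : nonzero (H1_eq D) V v by [].
have := coercivity_le alpha_le nv.
by rewrite ler_pdivlMr// exprn_gt0// normV_gt0.
Qed.

Let continuous_a v : V v -> a v v <= gamma * normV D v ^+ 2.
Proof.
move=> Vv; have [v0|nv0] := pselect (H1_eq D v 0).
  by rewrite normV_null// expr0n mulr0 a_null.
have nv : nonzero (H1_eq D) V v by [].
have := continuity_ge gamma_ge nv.
by rewrite ler_pdivrMr// exprn_gt0// normV_gt0.
Qed.

Let a_ge0 v : V v -> 0 <= a v v.
Proof.
by move=> Vv; apply: le_trans (coercive Vv); rewrite mulr_ge0 ?sqr_ge0 ?(ltW alpha_gt0).
Qed.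

Let projection v : V v -> exists z p, [/\ V z, Q p,
  forall u, V u -> a z u = b u p & forall q, Q q -> b z q = b v q].
Proof.
move=> Vv; have [n [e [Ve espan]]] := Vfin; have [m [g [Qg gspan]]] := Qfin.
apply: (saddle_projection VV QQ aV bVQ a_sym a_ge0 Ve Qg) => //.
- move=> z Vz; have [c zc] := espan _ Vz; exists c.
  have Vs := linear_subspace_sum VV c Ve.
  split=> [u Vu|q Qq].
    exact: (aform_ae oD nuP KP (VH Vz) (VH Vs) (VH Vu) zc).
  exact: (bform_ael oD (VH Vz) (VH Vs) (QL Qq) zc).
- move=> q Qq; have [c qc] := gspan _ Qq; exists c => u Vu.
  have Qs := linear_subspace_sum QQ c Qg.
  exact: (bform_aer oD (VH Vu) (QL Qq) (QL Qs) qc).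
Qed.

Lemma saddle_error_bound e p : V e -> Q p ->
  let beta := fine (inf_sup D V Q) in
  let r1 := fine (dual_normV D V (fun v => a e v + b v p)) in
  let r2 := fine (dual_normQ D Q (b e)) in
  normV D e <= alpha^-1 * r1 + 2 / beta * Num.sqrt (gamma / alpha) * r2 /\
  normQ D p <= 2 / beta * Num.sqrt (gamma / alpha) * r1 + gamma / beta ^+ 2 * r2.
Proof.
move=> Ve Qp beta r1 r2.
(* For trivial [V] the continuity constant is -oo and [gamma] may be negative, so this case comes
   first. Then [Q] is trivial too and both sides of each bound are 0. *)
have [Vtriv|/set0P[v0 nv0]] := eqVneq (nonzero (H1_eq D) V) set0.
  have Qtriv : nonzero (Q_eq D) Q = set0.
    apply/eqP; apply: contrapT => /negP/set0P[q nq].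
    by have [v] := inf_sup_nonzero VQ_inf_sup nq; rewrite Vtriv.
  have -> : r1 = 0 by exact: dual_norm_trivial.
  have -> : r2 = 0 by exact: dual_norm_trivial.
  rewrite !mulr0 !addr0 normV_null ?normQ_null//.
    by apply: contrapT => np; have : set0 p by rewrite -Qtriv.
  by apply: contrapT => ne; have : set0 e by rewrite -Vtriv.
(* Comparing coercivity and continuity at [v0] gives alpha <= gamma. *)
have gamma_ge0 : 0 <= gamma.
  have Vv0 := nv0.1; have := le_trans (coercive Vv0) (continuous_a Vv0).
  rewrite ler_pM2r ?exprn_gt0 ?normV_gt0// => /(le_trans _); apply.
  exact: ltW.
have normV_ge0 v : 0 <= normV D v by exact: sqrtr_ge0.
have normQ_ge0 q : 0 <= normQ D q by exact: sqrtr_ge0.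
have b_le v q : V v -> Q q -> b v q <= d%:R * normQ D q * normV D v.
  move=> Vv Qq; apply: le_trans (ler_norm _) _.
  by rewrite -mulrA [normQ D q * _]mulrC (bform_le oD (VH Vv) (QL Qq)).
(* The constant [C] comes from Cauchy-Schwarz for a and from [bform_le] for b. *)
have [r1_ge0 res1] : 0 <= r1 /\ forall v, V v -> a e v + b v p <= r1 * normV D v.
  apply: (dual_norm_ub VV (@H1_eq0N _ _ D) normV_ge0 normV_gt0 (@normVN _ _ D)
    (C := Num.sqrt (a e e) * Num.sqrt gamma + d%:R * normQ D p)).
  - move=> c u v Vu Vv; rewrite ((bVQ.1 _ Qp) c u v Vu Vv) ((aV.2 _ Ve) c u v Vu Vv).
    by ring.
  - by move=> v Vv v0'; rewrite a_null// b_nulll// addr0.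
  - move=> v Vv; rewrite mulrDl lerD ?b_le//.
    apply: le_trans (ler_norm _) _.
    apply: le_trans (cauchy_schwarz_sqrt VV aV a_sym a_ge0 Ve Vv) _.
    rewrite -mulrA ler_wpM2l ?sqrtr_ge0//.
    rewrite -[normV D v]ger0_norm// -sqrtr_sqr -sqrtrM// ler_wsqrtr//.
    exact: continuous_a.
have [r2_ge0 res2] : 0 <= r2 /\ forall q, Q q -> b e q <= r2 * normQ D q.
  apply: (dual_norm_ub QQ (@Q_eq0N _ _ D) normQ_ge0 normQ_gt0 (@normQN _ _ D)
    (C := d%:R * normV D e)).
  - exact: bVQ.2.
  - by move=> q Qq q0; rewrite b_nullr.
  - by move=> q Qq; rewrite mulrAC b_le.
have s_ge0 : 0 <= Num.sqrt (gamma / alpha) by exact: sqrtr_ge0.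
(* The inf-sup constant stays free here: it will be 1 when [Q] is trivial and [beta] otherwise. *)
have estimate beta' : 0 < beta' ->
    (forall q C, Q q -> 0 <= C -> (forall v, V v -> b v q <= C * normV D v) ->
      beta' * normQ D q <= C) ->
    normV D e <= alpha^-1 * r1 + beta'^-1 * Num.sqrt (gamma / alpha) * r2 /\
    normQ D p <= beta'^-1 * Num.sqrt (gamma / alpha) * r1 + gamma / beta' ^+ 2 * r2.
  move=> beta'_gt0 is_b; apply: (saddle_estimate VV aV bVQ a_sym projection) => //.
  exact: (sqrt_form_triangle VV sV (fun u v _ _ => innerVC D u v)
    (fun u _ => innerV_ge0 D u)).
have beta_ge0 : 0 <= beta by apply/fine_ge0/ltW.
have [Qtriv|/set0P[q0 nq0]] := eqVneq (nonzero (Q_eq D) Q) set0.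
  (* here beta = fine +oo = 0, and any positive inf-sup constant will do *)
  have Qnull q : Q q -> Q_eq D q 0.
    by move=> Qq; apply: contrapT => nq; have : set0 q by rewrite -Qtriv.
  have r20 : r2 = 0 by exact: dual_norm_trivial.
  have [||eV _] := estimate 1.
  - exact: ltr01.
  - by move=> q C Qq C0 _; rewrite normQ_null ?mulr0//; exact: Qnull.
  split; first by move: eV; rewrite r20 !mulr0.
  rewrite normQ_null//; last exact: Qnull.
  by rewrite r20 mulr0 addr0 !mulr_ge0// invr_ge0.
(* The boundedness of b at the nonzero [q0] rules out +oo, so [beta] is the genuine inf-sup
   constant. *)
have isE : inf_sup D V Q = beta%:E.
  rewrite fineK// fin_numE; apply/andP; split.
    by rewrite gt_eqF// (lt_trans _ VQ_inf_sup)// ltNy0.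
  rewrite lt_eqF//; apply: le_lt_trans (ltry (d%:R * normQ D q0 / normQ D q0)).
  apply: inf_sup_le => //; first exact: normQ_gt0.
  by move=> v Vv; apply: b_le => //; exact: nq0.1.
have beta_gt0 : 0 < beta by rewrite -lte_fin -isE.
have [||eV pQ] := estimate beta.
- exact: beta_gt0.
- move=> q C Qq C0 bC; have [qn|nqn] := pselect (Q_eq D q 0).
    by rewrite normQ_null// mulr0.
  have nq : nonzero (Q_eq D) Q q by [].
  rewrite -ler_pdivlMr ?normQ_gt0// -lee_fin -isE.
  by apply: inf_sup_le => //; exact: normQ_gt0.
(* The estimate holds with 1 / beta; the claimed 2 / beta is larger. *)
have double x : 0 <= x -> beta^-1 * Num.sqrt (gamma / alpha) * x <=
    2 / beta * Num.sqrt (gamma / alpha) * x.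
  by move=> x0; rewrite -!mulrA ler_peMl ?ler1n// !mulr_ge0// invr_ge0.
split; first by apply: le_trans eV _; rewrite lerD2l double.
by apply: le_trans pQ _; rewrite lerD2r double.
Qed.

End SaddleErrorBound.

(** * The reduced basis error as a saddle point problem *)

Theorem mainTheorem1 (R : realType) (d : nat) (d23 : d = 2%N \/ d = 3%N)
  (* domain and splitting of its boundary *)
  (D bD bN : set 'rV[R]_d)
  (D_bounded : bounded_set D) (D_connected : connected D) (D_open : open D)
  (D_lipschitz : lipschitz_boundary D)
  (bD_measurable : surface_measurable bD)
  (bN_measurable : surface_measurable bN)
  (boundary_split : bD `|` bN = boundary D) (boundary_disjoint : bD `&` bN = set0)
  (bD_positive : (0 < surface R d bD)%E) (bN_positive : (0 < surface R d bN)%E)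
  (* coefficients; the parameter set is the product of the [lo_i, hi_i] *)
  (nu : 'rV[R]_d -> R) (nu_viscosity : viscosity D nu)
  (M : nat) (lo hi : 'rV[R]_M)
  (K : 'rV[R]_M -> 'rV[R]_d -> 'M[R]_d)
  (K_permeability : forall xi, parameter_box lo hi xi -> permeability D (K xi))
  (* data; uD is the Dirichlet datum lifted by w *)
  (f uN uD : 'rV[R]_d -> 'rV[R]_d)
  (f_L2 : forall i, L2 (lebesgue R d) D (fun x => f x 0 i))
  (uN_L2 : forall i, L2 (surface R d) bN (fun x => uN x 0 i))
  (w : field R d) (w_H1 : H1 D w) (w_dirichlet : trace_eq D bD w uD)
  (* finite element spaces *)
  (Vh : set (field R d)) (Qh : set ('rV[R]_d -> R))
  (Vh_V : Vh `<=` Vspace D bD) (Qh_Q : Qh `<=` Qspace D)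
  (Vh_linear : linear_subspace Vh) (Qh_linear : linear_subspace Qh)
  (Vh_fin : finite_dimensional (H1_eq D) Vh)
  (Qh_fin : finite_dimensional (Q_eq D) Qh)
  (h_inf_sup : (0 < inf_sup D Vh Qh)%E)
  (* reduced basis spaces *)
  (Vr : set (field R d)) (Qr : set ('rV[R]_d -> R))
  (Vr_Vh : Vr `<=` Vh) (Qr_Qh : Qr `<=` Qh)
  (Vr_linear : linear_subspace Vr) (Qr_linear : linear_subspace Qr)
  (r_inf_sup : (0 < inf_sup D Vr Qr)%E)
  (* parameter, solutions, bounds for the constants *)
  (xi : 'rV[R]_M) (xi_in : parameter_box lo hi xi)
  (uh ur : field R d) (ph pr : 'rV[R]_d -> R)
  (h_solution : is_solution D bN nu (K xi) f uN w Vh Qh uh ph)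
  (r_solution : is_solution D bN nu (K xi) f uN w Vr Qr ur pr)
  (alphaLB gammaUB : R)
  (alphaLB_gt0 : 0 < alphaLB)
  (alphaLB_le : (alphaLB%:E <= coercivity D nu (K xi) Vh)%E)
  (gammaUB_ge : (continuity D nu (K xi) Vh <= gammaUB%:E)%E) :
  let beta := fine (inf_sup D Vh Qh) in
  let r1 := fine (dual_normV D Vh (residual1 D bN nu (K xi) f uN w ur pr)) in
  let r2 := fine (dual_normQ D Qh (residual2 D w ur)) in
  let Delta_u :=
    alphaLB^-1 * r1 + 2 / beta * Num.sqrt (gammaUB / alphaLB) * r2 in
  let Delta_p :=
    2 / beta * Num.sqrt (gammaUB / alphaLB) * r1 + gammaUB / beta ^+ 2 * r2 in
  normV D (uh - ur) <= Delta_u /\ normQ D (ph - pr) <= Delta_p.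
Proof.
have VH : Vh `<=` H1 D by move=> v /Vh_V[].
have [Vuh Quh h1 h2] := h_solution; have [Vur Qur _ _] := r_solution.
have Vur' := Vr_Vh _ Vur; have Qur' := Qr_Qh _ Qur.
have KP := K_permeability _ xi_in.
have aV := aform_bilinear D_open nu_viscosity KP Vh_linear VH.
have bVQ := bform_bilinear D_open VH Qh_Q.
move=> beta r1 r2 Delta_u Delta_p; rewrite /Delta_u /Delta_p /r1 /r2 /dual_normV /dual_normQ.
(* The high-fidelity equation replaces [ell1] by a(uh, .) + b(., ph). It holds on [Vh] alone, which
   suffices because the dual norm sees only values there. *)
rewrite (eq_dual_norm _ _ (l' := fun v => aform D nu (K xi) (uh - ur) v +
  bform D v (ph - pr))); last first.
  move=> v Vv; rewrite /residual1 -h1//.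
  rewrite (linear_onB Vh_linear (aV.1 _ Vv))// (linear_onB Qh_linear (bVQ.2 _ Vv))//.
  by ring.
rewrite (eq_dual_norm _ _ (l' := bform D (uh - ur))); last first.
  move=> q Qq; rewrite /residual2 -h2//.
  by rewrite (linear_onB Vh_linear (bVQ.1 _ Qq)).
apply: saddle_error_bound => //.
  exact: linear_subspaceB.
exact: linear_subspaceB.
Qed.
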